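(* As operators on holomorphic $V_\tau$-valued functions $f$ on $\Omega$, $$\mathcal{H}_M:=L(x)\sum_{i=1}^N(\mathcal{U}_i-1-\kappa\gamma)^2L(x)^{-1}=\sum_{i=1}^N(x_i\partial_i)^2-2\kappa\sum_{1\le i<j\le N}\frac{x_ix_j}{(x_i-x_j)^2}\bigl(\kappa-\sigma^M(i,j)\bigr).$$
   Context: Setup: $\tau$ is a partition of $N$ (not $(N)$, $(1^N)$) identified with the irreducible orthogonal representation of $\mathcal{S}_N$ on $V_\tau\cong\mathbb{C}^{n_\tau}$ (orthonormal basis), $\tau(i,j):=\tau((i,j))$. $c(i,T)=(\text{column of }i)-(\text{row of }i)$ in a standard tableau $T$, $S_1(\tau)=\sum_ic(i,T)$, $\gamma=S_1(\tau)/N$. $\mathcal{S}_N$ acts on $x$ by $(xw)_i=x_{w(i)}$. $\mathbb{C}^N_{reg}=\{x\in(\mathbb{C}\setminus\{0\})^N:x_i\neq x_j,\ i\ne j\}$; $\Omega\subset\mathbb{C}^N_{reg}$ is open with $\Omega w=\Omega$ for all $w$. $L:\Omega\to GL_{n_\tau}(\mathbb{C})$ is holomorphic and satisfies $\partial_iL(x)=\kappa L(x)\bigl\{\sum_{j\ne i}\frac{\tau(i,j)}{x_i-x_j}-\frac{\gamma}{x_i}I\bigr\}$, $1\le i\le N$ ($\kappa\in\mathbb{R}$). $M:\mathcal{S}_N\times\Omega\to GL_{n_\tau}(\mathbb{C})$ is locally constant in $x$ with $M(I,x)=I$, $M(w_1w_2,x)=M(w_2,xw_1)M(w_1,x)$,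 and $L(xw)=M(w,x)L(x)\tau(w)$. $(\sigma^M(w)f)(x)=M(w,x)^{-1}f(xw)$. The operators $\mathcal{D}_i g(x)=\partial_ig(x)+\kappa\sum_{j\ne i}\tau(i,j)\frac{g(x)-g(x(i,j))}{x_i-x_j}$ and $\mathcal{U}_ig(x)=\mathcal{D}_i(x_ig)(x)-\kappa\sum_{j<i}\tau(i,j)g(x(i,j))$ are applied to holomorphic $V_\tau$-valued functions $g$ on $\Omega$. *)

(* Defs.v *)
From Stdlib Require Import Reals ClassicalEpsilon.
From mathcomp Require Import all_boot all_fingroup.
Set Implicit Arguments. Unset Strict Implicit. Unset Printing Implicit Defensive.
Local Open Scope R_scope.

Definition C : Type := (R * R)%type.
Definition C0 : C := (0, 0).
Definition C1 : C := (1, 0).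
Definition RtoC (r : R) : C := (r, 0).
Definition Cadd (z w : C) : C := (fst z + fst w, snd z + snd w).
Definition Copp (z : C) : C := (- fst z, - snd z).
Definition Csub (z w : C) : C := Cadd z (Copp w).
Definition Cmul (z w : C) : C :=
  (fst z * fst w - snd z * snd w, fst z * snd w + snd z * fst w).
Definition Cnorm (z : C) : R := sqrt (fst z * fst z + snd z * snd z).
Definition Cinv (z : C) : C :=
  (fst z / (fst z * fst z + snd z * snd z),
   - snd z / (fst z * fst z + snd z * snd z)).
Definition Cdiv (z w : C) : C := Cmul z (Cinv w).

Definition Csum (m : nat) (F : 'I_m -> C) : C := \big[Cadd/C0]_(i < m) F i.
Definition Rsum (m : nat) (F : 'I_m -> R) : R := \big[Rplus/0]_(i < m) F i.

Definition pt (N : nat) : Type := 'I_N -> C.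
Definition vec (n : nat) : Type := 'I_n -> C.
Definition mat (n : nat) : Type := 'I_n -> 'I_n -> C.

Definition vzero n : vec n := fun _ => C0.
Definition vadd n (u v : vec n) : vec n := fun a => Cadd (u a) (v a).
Definition vsub n (u v : vec n) : vec n := fun a => Csub (u a) (v a).
Definition vscale n (c : C) (u : vec n) : vec n := fun a => Cmul c (u a).
Definition vsum n m (F : 'I_m -> vec n) : vec n := fun a => Csum (fun j => F j a).

Definition mid n : mat n := fun a b => if a == b then C1 else C0.
Definition madd n (A B : mat n) : mat n := fun a b => Cadd (A a b) (B a b).
Definition msub n (A B : mat n) : mat n := fun a b => Csub (A a b) (B a b).
Definition mscale n (c : C) (A : mat n) : mat n := fun a b => Cmul c (A a b).
Definition msum n m (F : 'I_m -> mat n) : mat n := fun a b => Csum (fun j => F j a b).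
Definition mmul n (A B : mat n) : mat n := fun a b => Csum (fun c => Cmul (A a c) (B c b)).
Definition mvmul n (A : mat n) (v : vec n) : vec n := fun a => Csum (fun c => Cmul (A a c) (v c)).
Definition minvertible n (A : mat n) : Prop :=
  exists B : mat n, mmul A B = @mid n /\ mmul B A = @mid n.
(* the inverse matrix (meaningful when A is invertible) *)
Definition minv n (A : mat n) : mat n :=
  epsilon (inhabits (@mid n)) (fun B => mmul A B = @mid n /\ mmul B A = @mid n).

Definition pact N (x : pt N) (w : {perm 'I_N}) : pt N := fun i => x (w i).
(* the product w1 w2 = w1 o w2 (w2 applied first); note MathComp's (s * t) i = t (s i) *)
Definition wcomp N (w1 w2 : {perm 'I_N}) : {perm 'I_N} := (w2 * w1)%g.

Definition is_partition_of (N : nat) (lam : seq nat) : bool :=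
  [&& sorted geq lam, all (fun p => 0 < p)%N lam & sumn lam == N].
Definition in_shape (lam : seq nat) (r c : nat) : bool := (c < nth 0%N lam r)%N.

(* a tableau with entries 0..N-1 is encoded by T : entry |-> (row, column) *)
Definition tableau (N : nat) := {ffun 'I_N -> 'I_N * 'I_N}.
Definition is_standard N (lam : seq nat) (T : tableau N) : bool :=
  [forall i, in_shape lam (T i).1 (T i).2] && injectiveb T &&
  [forall i, forall j,
     (((T i).1 == (T j).1) && ((T i).2 < (T j).2)%N ==> (i < j)%N) &&
     (((T i).2 == (T j).2) && ((T i).1 < (T j).1)%N ==> (i < j)%N)].
Definition syts N (lam : seq nat) : seq (tableau N) :=
  enum [pred T : tableau N | is_standard lam T].
(* n_tau = number of standard tableaux = dim V_tau *)
Definition ntau N (lam : seq nat) : nat := size (syts N lam).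
Definition tab0 N : tableau N := [ffun i => (i, i)].
Definition tab_of N lam (a : 'I_(ntau N lam)) : tableau N := nth (tab0 N) (syts N lam) a.
Definition content N (T : tableau N) (i : 'I_N) : R := (INR (T i).2 - INR (T i).1).
Definition S1 (lam : seq nat) : R :=
  \big[Rplus/0]_(r < size lam) \big[Rplus/0]_(c < nth 0%N lam r) (INR c - INR r).
(* Young's orthogonal form for the adjacent transposition (k, k+1) = (i, j):
   s_k v_T = (1/r) v_T + sqrt(1 - 1/r^2) v_{s_k T},  r = c(k+1,T) - c(k,T). *)
Definition tab_swap N (i j : 'I_N) (T : tableau N) : tableau N := [ffun e => T (tperm i j e)].
Definition young_adj N lam (i j : 'I_N) : mat (ntau N lam) :=
  fun a b =>
    let r := (content (tab_of b) j - content (tab_of b) i) in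
    if a == b then RtoC (/ r)
    else if tab_of a == tab_swap i j (tab_of b) then RtoC (sqrt (1 - / (r * r)))
    else C0.

Definition near_pt N (x y : pt N) (d : R) : Prop := forall i, (Cnorm (Csub (y i) (x i)) < d).
Definition open_pts N (Om : pt N -> Prop) : Prop :=
  forall x, Om x -> exists d, (0 < d) /\ forall y, near_pt x y d -> Om y.
Definition regular_pt N (x : pt N) : Prop :=
  (forall i, x i <> C0) /\ (forall i j, i <> j -> x i <> x j).
Definition pupd N (x : pt N) (i : 'I_N) (h : C) : pt N :=
  fun k => if k == i then Cadd (x k) h else x k.
Definition has_pderiv N (g : pt N -> C) (i : 'I_N) (x : pt N) (d : C) : Prop :=
  forall eps, (0 < eps) -> exists del, (0 < del) /\
    forall h, (0 < Cnorm h < del) ->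
      (Cnorm (Csub (Cdiv (Csub (g (pupd x i h)) (g x)) h) d) < eps).
Definition pderiv N (g : pt N -> C) (i : 'I_N) (x : pt N) : C :=
  epsilon (inhabits C0) (fun d => has_pderiv g i x d).
Definition holo_at N (g : pt N -> C) (x : pt N) : Prop :=
  exists d : 'I_N -> C, forall eps, (0 < eps) -> exists del, (0 < del) /\
    forall y, near_pt x y del ->
      (Cnorm (Csub (Csub (g y) (g x)) (Csum (fun i => Cmul (d i) (Csub (y i) (x i)))))
        <= eps * Rsum (fun i => Cnorm (Csub (y i) (x i)))).
Definition holomorphic N (Om : pt N -> Prop) (g : pt N -> C) : Prop :=
  forall x, Om x -> holo_at g x.
Definition holomorphic_vec N n (Om : pt N -> Prop) (f : pt N -> vec n) : Prop :=
  forall a, holomorphic Om (fun y => f y a).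
Definition holomorphic_mat N n (Om : pt N -> Prop) (L : pt N -> mat n) : Prop :=
  forall a b, holomorphic Om (fun y => L y a b).
Definition vpderiv N n (f : pt N -> vec n) (i : 'I_N) (x : pt N) : vec n :=
  fun a => pderiv (fun y => f y a) i x.
Definition mpderiv N n (L : pt N -> mat n) (i : 'I_N) (x : pt N) : mat n :=
  fun a b => pderiv (fun y => L y a b) i x.

Section Ops.
Variables (N n : nat) (kap : R) (tau : {perm 'I_N} -> mat n).

Definition Dop (i : 'I_N) (g : pt N -> vec n) : pt N -> vec n :=
  fun x => vadd (vpderiv g i x)
    (vscale (RtoC kap) (vsum (fun j : 'I_N =>
       if j == i then @vzero n
       else vscale (Cinv (Csub (x i) (x j)))
              (mvmul (tau (tperm i j)) (vsub (g x) (g (pact x (tperm i j)))))))).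

Definition Uop (i : 'I_N) (g : pt N -> vec n) : pt N -> vec n :=
  fun x => vsub (Dop i (fun y => vscale (y i) (g y)) x)
    (vscale (RtoC kap) (vsum (fun j : 'I_N =>
       if (j < i)%N then mvmul (tau (tperm i j)) (g (pact x (tperm i j))) else @vzero n))).

Definition Ushift (gam : R) (i : 'I_N) (g : pt N -> vec n) : pt N -> vec n :=
  fun x => vsub (Uop i g x) (vscale (RtoC (1 + kap * gam)) (g x)).

Definition Euler (i : 'I_N) (f : pt N -> vec n) : pt N -> vec n :=
  fun x => vscale (x i) (vpderiv f i x).
End Ops.

Definition sigmaM N n (M : {perm 'I_N} -> pt N -> mat n) (w : {perm 'I_N})
  (f : pt N -> vec n) : pt N -> vec n :=
  fun x => mvmul (minv (M w x)) (f (pact x w)).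

(* Main.v *)
(* Put [B_i F = x_i d_i F - kappa sum_{j != i} phi_ij sigma^M(i,j) F] with
   [phi_ij = x_max(i,j) / (x_i - x_j)], which is antisymmetric in [i, j].  The
   differential equation and the monodromy relation for [L] give
   [L (U_i - 1 - kappa gamma) L^-1 = B_i].  In [sum_i B_i^2] the first-order cross
   terms cancel by antisymmetry of [phi], the derivatives of [phi_ij] and the terms
   [sigma(i,j)^2 = 1] produce the potential, and the terms with [i, j, k] distinct
   cancel along the three rotations that give the same 3-cycle.

   Applying [B_i] twice requires [d_i f] to be differentiable again, for [f] that is
   only assumed complex differentiable; this comes from Goursat's lemma and Cauchy's
   formula on squares. *)
From HB Require Import structures.
From Coquelicot Require Import Hierarchy Continuity Derive RInt RInt_analysis AutoDerive.
From Coquelicot Require Complex.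
Require Import Defs.
From Stdlib Require Import Reals ClassicalEpsilon.
From Stdlib Require Import FunctionalExtensionality Lra.
From mathcomp Require Import all_boot all_fingroup.
(* [Reals] also exports a [C] (binomial coefficients). *)
Import Defs.
Local Open Scope R_scope.

(* Differentiating [L (L^-1 F) = F] replaces [L d_i(L^-1 F)] by [d_i F] minus a term that the
   differential equation supplies. The relation [L(xw) = M(w,x) L(x) tau(w)] turns
   [L(x) tau(w) L(xw)^-1] into [M(w,x)^-1], and since [M] is locally constant a derivative passes
   through [sigma^M(i,j)], with [d_i] becoming [d_j]. The obstacle is that [pderiv] and [minv] are
   choices made by [epsilon]: they carry information only once existence is known. Differentiability
   of [L^-1] and of [d_i f] therefore has to be established before anything is computed. In [B_i^2]
   the only second derivative is the pure one in [x_i], because the reflected terms contribute first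
   derivatives only; one-variable theory therefore suffices. Rectangles instead of circles make
   every contour integral a pair of real integrals along coordinate lines, and the only nontrivial
   one to be evaluated is an arctangent. *)
Declare Scope C_scope.
Delimit Scope C_scope with C.
Notation "z + w" := (Cadd z w) : C_scope.
Notation "- z" := (Copp z) : C_scope.
Notation "z - w" := (Csub z w) : C_scope.
Notation "z * w" := (Cmul z w) : C_scope.
Notation "z / w" := (Cdiv z w) : C_scope.

(** * Complex numbers: field structure and modulus *)

Lemma Ceta (z : C) : z = (fst z, snd z).
Proof. by case: z. Qed.

Lemma C_ext (z w : C) : fst z = fst w -> snd z = snd w -> z = w.
Proof. by case: z => a b; case: w => c d /= -> ->. Qed.

Lemma C_neq0 (z : C) : z <> C0 -> 0 < fst z * fst z + snd z * snd z.
Proof.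
case: z => a b H /=.
have [Ha|Ha] := Req_dec a 0; have [Hb|Hb] := Req_dec b 0; try nra.
by case: H; rewrite Ha Hb.
Qed.

Lemma C_field_theory : field_theory C0 C1 Cadd Cmul Csub Copp Cdiv Cinv eq.
Proof.
constructor.
- by constructor; intros; apply C_ext => /=; try ring.
- by move=> /(f_equal fst) /=; lra.
- by [].
move=> z /C_neq0 Hz; apply C_ext => /=; field; lra.
Qed.
Add Field C_field : C_field_theory.

Lemma CnormE (z : C) : Cnorm z = Complex.Cmod z.
Proof. by rewrite /Cnorm /Complex.Cmod /= !Rmult_1_r. Qed.

Lemma Cnorm_ge0 (z : C) : 0 <= Cnorm z.
Proof. exact: sqrt_pos. Qed.

Lemma Cnorm_triangle (z w : C) : Cnorm (z + w)%C <= Cnorm z + Cnorm w.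
Proof. rewrite !CnormE; exact: Complex.Cmod_triangle. Qed.

Lemma Cnorm_mul (z w : C) : Cnorm (z * w)%C = Cnorm z * Cnorm w.
Proof. rewrite !CnormE; exact: Complex.Cmod_mult. Qed.

Lemma Cnorm_opp (z : C) : Cnorm (- z)%C = Cnorm z.
Proof. rewrite !CnormE; exact: Complex.Cmod_opp. Qed.

Lemma Cnorm_sub (z w : C) : Cnorm (z - w)%C <= Cnorm z + Cnorm w.
Proof. by rewrite -(Cnorm_opp w); exact: Cnorm_triangle. Qed.

Lemma Cnorm0 : Cnorm C0 = 0.
Proof. by rewrite /Cnorm /= Rmult_0_l Rplus_0_l sqrt_0. Qed.

Lemma Cnorm1 : Cnorm C1 = 1.
Proof. by rewrite CnormE; exact: Complex.Cmod_1. Qed.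

Lemma Cnorm_eq0 (z : C) : Cnorm z = 0 -> z = C0.
Proof. rewrite CnormE; exact: Complex.Cmod_eq_0. Qed.

Lemma Cnorm_gt0 (z : C) : z <> C0 -> 0 < Cnorm z.
Proof.
move=> Hz; case: (Cnorm_ge0 z) => // H; by case: Hz; apply Cnorm_eq0.
Qed.

Lemma Cnorm_neq0 (z : C) : 0 < Cnorm z -> z <> C0.
Proof. by move=> H E; rewrite E Cnorm0 in H; lra. Qed.

Lemma Cnorm_inv (z : C) : z <> C0 -> Cnorm (Cinv z) = / Cnorm z.
Proof.
move=> Hz; have H := Cnorm_gt0 z Hz.
apply: (Rmult_eq_reg_l (Cnorm z)); last by lra.
rewrite -Cnorm_mul Rinv_r; last by lra.
by rewrite -Cnorm1; congr Cnorm; field.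
Qed.

Lemma Cnorm_RtoC (r : R) : Cnorm (RtoC r) = Rabs r.
Proof. rewrite CnormE; exact: Complex.Cmod_R. Qed.

Lemma fst_le_Cnorm (z : C) : Rabs (fst z) <= Cnorm z.
Proof.
rewrite CnormE; apply: Rle_trans (Complex.Rmax_Cmod z); exact: Rmax_l.
Qed.

Lemma snd_le_Cnorm (z : C) : Rabs (snd z) <= Cnorm z.
Proof.
rewrite CnormE; apply: Rle_trans (Complex.Rmax_Cmod z); exact: Rmax_r.
Qed.

Lemma Cnorm_le_sum (z : C) : Cnorm z <= Rabs (fst z) + Rabs (snd z).
Proof.
rewrite /Cnorm -(sqrt_square (Rabs _ + Rabs _)); last first.
  by have := Rabs_pos (fst z); have := Rabs_pos (snd z); lra.
apply: sqrt_le_1_alt.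
have := Rabs_pos (fst z); have := Rabs_pos (snd z).
have := Rsqr_abs (fst z); have := Rsqr_abs (snd z); rewrite /Rsqr; nra.
Qed.

Lemma Cnorm_sub_rev (z w : C) : Cnorm z - Cnorm w <= Cnorm (z - w)%C.
Proof.
have := Cnorm_triangle (z - w)%C w.
have -> : (z - w + w)%C = z by ring.
lra.
Qed.

(** * One complex variable: derivatives *)

(** A form of the derivative without quotients: [u = 0] is allowed and nothing is divided, so sum,
    product and chain rules become norm estimates. [has_pdE] links it to the quotient form. *)
Definition has_cderiv (h : C -> C) (z d : C) : Prop :=
  forall eps, 0 < eps -> exists del, 0 < del /\ forall u, Cnorm u < del ->
    Cnorm (h (z + u) - h z - d * u)%C <= eps * Cnorm u.

Lemma has_cderiv_continuous (h : C -> C) (z d : C) : has_cderiv h z d ->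
  forall eps, 0 < eps -> exists del, 0 < del /\ forall u, Cnorm u < del ->
    Cnorm (h (z + u) - h z)%C < eps.
Proof.
move=> Hh eps He.
have [del [Hd H]] := Hh 1 Rlt_0_1.
have Hn := Cnorm_ge0 d.
have Hp : 0 < eps / (2 * (1 + Cnorm d)) by apply: Rdiv_lt_0_compat; lra.
exists (Rmin del (eps / (2 * (1 + Cnorm d)))); split.
  by apply: Rmin_glb_lt.
move=> u Hu.
have H1 : Cnorm u < del by apply: Rlt_le_trans Hu (Rmin_l _ _).
have H2 : Cnorm u < eps / (2 * (1 + Cnorm d)) by apply: Rlt_le_trans Hu (Rmin_r _ _).
have H3 := H u H1.
have -> : (h (z + u) - h z = (h (z + u) - h z - d * u) + d * u)%C by ring.
apply: Rle_lt_trans (Cnorm_triangle _ _) _; rewrite Cnorm_mul.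
have H4 : (1 + Cnorm d) * Cnorm u < (1 + Cnorm d) * (eps / (2 * (1 + Cnorm d))).
  by apply: Rmult_lt_compat_l => //; lra.
have H5 : (1 + Cnorm d) * (eps / (2 * (1 + Cnorm d))) = eps / 2 by field; lra.
lra.
Qed.


Lemma has_cderiv_near (g h : C -> C) (z d : C) (r : R) : 0 < r ->
  (forall u, Cnorm u < r -> g (z + u)%C = h (z + u)%C) ->
  has_cderiv g z d -> has_cderiv h z d.
Proof.
move=> Hr E Hg eps He.
have [del [Hd H]] := Hg eps He.
exists (Rmin del r); split; first by apply: Rmin_glb_lt.
move=> u Hu.
have Ez : g z = h z.
  have := E C0; rewrite Cnorm0 => /(_ Hr).
  by have -> : (z + C0)%C = z by ring.
rewrite -E -?Ez; first by apply: H; apply: Rlt_le_trans Hu (Rmin_l _ _).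
by apply: Rlt_le_trans Hu (Rmin_r _ _).
Qed.

Lemma has_cderiv_unique (h : C -> C) (z d1 d2 : C) :
  has_cderiv h z d1 -> has_cderiv h z d2 -> d1 = d2.
Proof.
move=> H1 H2.
have [E|NE] := Req_dec (Cnorm (d1 - d2)%C) 0.
  have E2 := Cnorm_eq0 _ E.
  have -> : d1 = ((d1 - d2) + d2)%C by ring.
  by rewrite E2; ring.
have Hp : 0 < Cnorm (d1 - d2)%C by have := Cnorm_ge0 (d1 - d2)%C; lra.
set e := Cnorm (d1 - d2)%C in NE Hp.
have [a [Ha HA]] := H1 (e / 4) ltac:(lra).
have [b [Hb HB]] := H2 (e / 4) ltac:(lra).
set t := Rmin a b / 2.
have Hm : 0 < Rmin a b by apply: Rmin_glb_lt.
have Ht : Cnorm (RtoC t) = t by rewrite Cnorm_RtoC Rabs_pos_eq /t; lra.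
have := HA (RtoC t); have := HB (RtoC t); rewrite Ht.
have := Rmin_l a b; have := Rmin_r a b => Mb Ma.
move=> /(_ ltac:(rewrite /t; lra)) B /(_ ltac:(rewrite /t; lra)) A.
have H : Cnorm ((d1 - d2) * RtoC t)%C <= e / 4 * t + e / 4 * t.
  have -> : ((d1 - d2) * RtoC t = (h (z + RtoC t) - h z - d2 * RtoC t)
     - (h (z + RtoC t) - h z - d1 * RtoC t))%C by ring.
  apply: Rle_trans (Cnorm_sub _ _) _; lra.
rewrite Cnorm_mul Ht -/e in H.
have : 0 < t by rewrite /t; lra.
nra.
Qed.

Lemma has_cderiv_const (c z : C) : has_cderiv (fun _ => c) z C0.
Proof.
move=> eps He; exists 1; split=> [|u _]; first lra.
have -> : (c - c - C0 * u = C0)%C by ring.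
by rewrite Cnorm0; have := Cnorm_ge0 u; nra.
Qed.

Lemma has_cderiv_id (z : C) : has_cderiv (fun w => w) z C1.
Proof.
move=> eps He; exists 1; split=> [|u _]; first lra.
have -> : (z + u - z - C1 * u = C0)%C by ring.
by rewrite Cnorm0; have := Cnorm_ge0 u; nra.
Qed.

Lemma has_cderiv_add (g h : C -> C) (z a b : C) :
  has_cderiv g z a -> has_cderiv h z b ->
  has_cderiv (fun w => g w + h w)%C z (a + b)%C.
Proof.
move=> Hg Hh eps He.
have [d1 [P1 H1]] := Hg (eps / 2) ltac:(lra).
have [d2 [P2 H2]] := Hh (eps / 2) ltac:(lra).
exists (Rmin d1 d2); split; first by apply: Rmin_glb_lt.
move=> u Hu.
have := H1 u (Rlt_le_trans _ _ _ Hu (Rmin_l _ _)).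
have := H2 u (Rlt_le_trans _ _ _ Hu (Rmin_r _ _)) => A B.
have -> : (g (z + u) + h (z + u) - (g z + h z) - (a + b) * u =
  (g (z + u) - g z - a * u) + (h (z + u) - h z - b * u))%C by ring.
apply: Rle_trans (Cnorm_triangle _ _) _; lra.
Qed.

Lemma has_cderiv_mul (g h : C -> C) (z a b : C) :
  has_cderiv g z a -> has_cderiv h z b ->
  has_cderiv (fun w => g w * h w)%C z (a * h z + g z * b)%C.
Proof.
move=> Hg Hh eps He.
set A := Cnorm a; set G := Cnorm (g z); set Z := Cnorm (h z).
have A0 : 0 <= A by exact: Cnorm_ge0.
have G0 : 0 <= G by exact: Cnorm_ge0.
have Z0 : 0 <= Z by exact: Cnorm_ge0.
(* The three error terms below add up to at most [e * (1 + A + G + Z) * Cnorm u], once the increment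
   of [h] is below both 1 and [e]. *)
set e := eps / (3 * (1 + A + G + Z)).
have e0 : 0 < e by apply: Rdiv_lt_0_compat; lra.
have eE : e * (1 + A + G + Z) = eps / 3 by rewrite /e; field; lra.
have [d1 [P1 H1]] := Hg e e0.
have [d2 [P2 H2]] := Hh e e0.
have [d3 [P3 H3]] := has_cderiv_continuous _ _ _ Hh (Rmin 1 e) ltac:(apply: Rmin_glb_lt; lra).
exists (Rmin (Rmin d1 d2) d3); split; first by do 2 apply: Rmin_glb_lt => //.
move=> u Hu.
have L12 := Rmin_l (Rmin d1 d2) d3; have L3 := Rmin_r (Rmin d1 d2) d3.
have L1 := Rmin_l d1 d2; have L2 := Rmin_r d1 d2.
have {}H1 := H1 u ltac:(lra); have {}H2 := H2 u ltac:(lra); have {}H3 := H3 u ltac:(lra).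
have M1 := Rmin_l 1 e; have M2 := Rmin_r 1 e.
have -> : (g (z + u) * h (z + u) - g z * h z - (a * h z + g z * b) * u =
  (g (z + u) - g z - a * u) * h z + g z * (h (z + u) - h z - b * u)
  + ((g (z + u) - g z - a * u) + a * u) * (h (z + u) - h z))%C by ring.
apply: Rle_trans (Cnorm_triangle _ _) _.
apply: Rle_trans (Rplus_le_compat_r _ _ _ (Cnorm_triangle _ _)) _.
rewrite !Cnorm_mul -/G -/Z.
have T := Cnorm_triangle (g (z + u) - g z - a * u)%C (a * u)%C.
rewrite Cnorm_mul -/A in T.
have u0 := Cnorm_ge0 u.
set p := Cnorm (g (z + u) - g z - a * u)%C in H1 T *.
set q := Cnorm (h (z + u) - h z - b * u)%C in H2 *.
set s := Cnorm (h (z + u) - h z)%C in H3 *.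
set v := Cnorm u in H1 H2 u0 T *.
set w := Cnorm (_ + _)%C in T *.
have s0 : 0 <= s by exact: Cnorm_ge0.
have p0 : 0 <= p by exact: Cnorm_ge0.
have X1 : p * Z <= e * v * Z by apply: Rmult_le_compat_r.
have X2 : G * q <= G * (e * v) by apply: Rmult_le_compat_l.
have X3 : w * s <= (e * v + A * v) * s by apply: Rmult_le_compat_r => //; lra.
have X4 : e * v * s <= e * v * 1.
  by apply: Rmult_le_compat_l; [apply: Rmult_le_pos; lra | lra].
have X5 : A * v * s <= A * v * e.
  by apply: Rmult_le_compat_l; [apply: Rmult_le_pos; lra | lra].
have : e * (1 + A + G + Z) * v = eps / 3 * v by rewrite eE.
have : 0 <= eps * v by apply: Rmult_le_pos; lra.
lra.
Qed.

Lemma has_cderiv_sub (g h : C -> C) (z a b : C) :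
  has_cderiv g z a -> has_cderiv h z b ->
  has_cderiv (fun w => g w - h w)%C z (a - b)%C.
Proof.
move=> Hg Hh.
have H := has_cderiv_add _ _ _ _ _ Hg (has_cderiv_mul _ _ _ _ _ (has_cderiv_const (- C1)%C z) Hh).
move: H; have -> : (a + (C0 * h z + (- C1) * b) = a - b)%C by ring.
by apply: (has_cderiv_near _ _ _ _ 1 Rlt_0_1) => u _; ring.
Qed.

Lemma has_cderiv_inv (z : C) : z <> C0 -> has_cderiv Cinv z (- (Cinv z * Cinv z))%C.
Proof.
move=> Hz eps He.
set n := Cnorm z; have n0 : 0 < n by exact: Cnorm_gt0.
(* The remainder is exactly [u^2 / (z^2 (z + u))]. The first bound on [u] keeps [Cnorm (z + u)]
   above [n / 2]; the second makes [2 * Cnorm u / n^3] at most [eps]. *)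
exists (Rmin (n / 2) (eps * (n * n * n) / 2)); split.
  apply: Rmin_glb_lt; first lra.
  have n3 := Rmult_lt_0_compat _ _ (Rmult_lt_0_compat _ _ n0 n0) n0.
  by have := Rmult_lt_0_compat _ _ He n3; lra.
move=> u Hu.
have L1 := Rmin_l (n / 2) (eps * (n * n * n) / 2).
have L2 := Rmin_r (n / 2) (eps * (n * n * n) / 2).
have Hzu : n / 2 < Cnorm (z + u)%C.
  have := Cnorm_sub_rev z (- u)%C; rewrite Cnorm_opp -/n.
  have -> : (z - - u = z + u)%C by ring.
  lra.
have Hzu0 : (z + u)%C <> C0 by apply: Cnorm_neq0; lra.
have -> : (Cinv (z + u) - Cinv z - - (Cinv z * Cinv z) * u =
   u * u * (Cinv z * Cinv z * Cinv (z + u)))%C by field.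
rewrite !Cnorm_mul !Cnorm_inv // -/n.
set v := Cnorm u in Hu *; have v0 : 0 <= v by exact: Cnorm_ge0.
have -> : v * v * (/ n * / n * / Cnorm (z + u)%C) = (v * (/ n * / n * / Cnorm (z + u)%C)) * v by ring.
apply: Rmult_le_compat_r => //.
have I0 : / Cnorm (z + u)%C <= / (n / 2) by apply: Rinv_le_contravar; lra.
have Hi : 0 < / n by apply: Rinv_0_lt_compat.
apply: (Rle_trans _ (v * (/ n * / n * / (n / 2)))).
  apply: Rmult_le_compat_l => //; apply: Rmult_le_compat_l => //.
  by apply: Rmult_le_pos; lra.
apply: (Rle_trans _ (eps * (n * n * n) / 2 * (/ n * / n * / (n / 2)))).
  apply: Rmult_le_compat_r; last lra.
  have Hi2 : 0 < / (n / 2) by apply: Rinv_0_lt_compat; lra.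
  by left; apply: Rmult_lt_0_compat => //; apply: Rmult_lt_0_compat.
by right; field; lra.
Qed.

Lemma has_cderiv_comp_sub (h : C -> C) (a z d : C) :
  has_cderiv h (z - a)%C d -> has_cderiv (fun w => h (w - a)%C) z d.
Proof.
move=> H eps He; have [del [Hd Hh]] := H eps He.
exists del; split=> // u Hu.
have -> : (z + u - a = z - a + u)%C by ring.
exact: Hh.
Qed.

(** * Complex integrals along segments *)

Definition cdiff (F : C -> C) (z : C) : Prop := exists d, has_cderiv F z d.

Definition CInt (f : R -> C) (a b : R) : C :=
  (RInt (fun t => fst (f t)) a b, RInt (fun t => snd (f t)) a b).

Definition Cintegrable (f : R -> C) (a b : R) : Prop :=
  ex_RInt (fun t => fst (f t)) a b /\ ex_RInt (fun t => snd (f t)) a b.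

Lemma RInt_plusR (f g : R -> R) a b : ex_RInt f a b -> ex_RInt g a b ->
  RInt (fun t => f t + g t) a b = RInt f a b + RInt g a b.
Proof. exact: (@RInt_plus R_CompleteNormedModule). Qed.

Lemma RInt_scalR (f : R -> R) l a b : ex_RInt f a b ->
  RInt (fun t => l * f t) a b = l * RInt f a b.
Proof. exact: (@RInt_scal R_CompleteNormedModule). Qed.

Lemma ex_RInt_scalR (f : R -> R) l a b : ex_RInt f a b ->
  ex_RInt (fun t => l * f t) a b.
Proof. exact: (@ex_RInt_scal R_CompleteNormedModule). Qed.

Lemma RInt_extR (f g : R -> R) a b : (forall t, f t = g t) -> RInt f a b = RInt g a b.
Proof. by move=> H; apply: RInt_ext => t _; exact: H. Qed.

Lemma CInt_add (f g : R -> C) a b : Cintegrable f a b -> Cintegrable g a b ->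
  CInt (fun t => f t + g t)%C a b = (CInt f a b + CInt g a b)%C.
Proof.
move=> [f1 f2] [g1 g2]; rewrite /CInt /Cadd /=.
by rewrite !RInt_plusR.
Qed.

Lemma CInt_scal (f : R -> C) (k : C) a b : Cintegrable f a b ->
  CInt (fun t => k * f t)%C a b = (k * CInt f a b)%C.
Proof.
move=> [f1 f2]; rewrite /CInt /Cmul /=; apply C_ext => /=.
  rewrite (RInt_extR _ (fun t => fst k * fst (f t) + (- snd k) * snd (f t))); last first.
    by move=> t; ring.
  by rewrite RInt_plusR ?RInt_scalR //; [ring | exact: ex_RInt_scalR | exact: ex_RInt_scalR].
by rewrite RInt_plusR ?RInt_scalR //; exact: ex_RInt_scalR.
Qed.

(** The factor 2 comes from bounding real and imaginary parts separately. The sharp constant 1 would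
    gain nothing, since every use lets an error tend to 0. *)
Lemma CInt_norm_le (f : R -> C) a b M : a <= b -> Cintegrable f a b ->
  (forall t, a <= t <= b -> Cnorm (f t) <= M) -> Cnorm (CInt f a b) <= 2 * M * (b - a).
Proof.
move=> Hab [f1 f2] H.
apply: Rle_trans (Cnorm_le_sum _) _ => /=.
have A1 : Rabs (RInt (fun t => fst (f t)) a b) <= (b - a) * M.
  by apply: abs_RInt_le_const => // t Ht; apply: Rle_trans (fst_le_Cnorm _) (H t Ht).
have A2 : Rabs (RInt (fun t => snd (f t)) a b) <= (b - a) * M.
  by apply: abs_RInt_le_const => // t Ht; apply: Rle_trans (snd_le_Cnorm _) (H t Ht).
lra.
Qed.

Definition seg (p q : C) (t : R) : C := (p + RtoC t * q)%C.

Definition segint (F : C -> C) (p q : C) (a b : R) : C :=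
  (q * CInt (fun t => F (seg p q t)) a b)%C.

(** Complex differentiability along the segment gives continuity, hence integrability, and is stable
    under the algebra of integrands. Unit speed makes [b - a] the length. *)
Definition seg_ok (F : C -> C) (p q : C) (a b : R) : Prop :=
  [/\ a <= b, Cnorm q = 1 & forall t, a <= t <= b -> cdiff F (seg p q t)].

Lemma seg_continuity (F : C -> C) (p q : C) (t : R) : Cnorm q = 1 ->
  cdiff F (seg p q t) ->
  continuous (fun s => fst (F (seg p q s))) t /\ continuous (fun s => snd (F (seg p q s))) t.
Proof.
move=> Hq [d Hd].
have K eps : 0 < eps -> exists alp, alp > 0 /\ forall s, Rabs (s - t) < alp ->
    Cnorm (F (seg p q s) - F (seg p q t))%C < eps.
  move=> He; have [del [H0 H]] := has_cderiv_continuous _ _ _ Hd eps He.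
  exists del; split=> // s Hs.
  have -> : seg p q s = (seg p q t + RtoC (s - t) * q)%C.
    by rewrite /seg; apply C_ext => /=; ring.
  by apply: H; rewrite Cnorm_mul Hq Rmult_1_r Cnorm_RtoC.
by split; apply/continuity_pt_filterlim => eps He;
  have [alp [H0 H]] := K eps He; exists alp; split=> // s [_ Hs];
  apply: Rle_lt_trans (H s Hs);
  [have := fst_le_Cnorm (F (seg p q s) - F (seg p q t))%C
  |have := snd_le_Cnorm (F (seg p q s) - F (seg p q t))%C].
Qed.

Lemma seg_integrable (F : C -> C) p q a b : seg_ok F p q a b ->
  Cintegrable (fun t => F (seg p q t)) a b.
Proof.
move=> [Hab Hq H]; split; apply: (@ex_RInt_continuous R_CompleteNormedModule) => t;
  rewrite Rmin_left // Rmax_right // => Ht.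
- exact: (proj1 (seg_continuity F p q t Hq (H t Ht))).
- exact: (proj2 (seg_continuity F p q t Hq (H t Ht))).
Qed.

Lemma cdiff_add F G z : cdiff F z -> cdiff G z -> cdiff (fun w => F w + G w)%C z.
Proof. by move=> [a Ha] [b Hb]; exists (a + b)%C; exact: has_cderiv_add. Qed.

Lemma cdiff_mul F G z : cdiff F z -> cdiff G z -> cdiff (fun w => F w * G w)%C z.
Proof.
by move=> [a Ha] [b Hb]; exists (a * G z + F z * b)%C; exact: has_cderiv_mul.
Qed.

Lemma cdiff_const k z : cdiff (fun _ => k) z.
Proof. by exists C0; exact: has_cderiv_const. Qed.

Lemma cdiff_id z : cdiff (fun w => w) z.
Proof. by exists C1; exact: has_cderiv_id. Qed.

Lemma cdiff_scal F k z : cdiff F z -> cdiff (fun w => k * F w)%C z.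
Proof. by move=> H; apply: cdiff_mul => //; exact: cdiff_const. Qed.

Lemma cdiff_inv_sub (z w : C) : w <> z -> cdiff (fun v => Cinv (v - z))%C w.
Proof.
move=> H; exists (- (Cinv (w - z) * Cinv (w - z)))%C.
apply: (has_cderiv_comp_sub Cinv); apply: has_cderiv_inv => E; apply: H.
by have -> : w = (w - z + z)%C; [ring | rewrite E; ring].
Qed.

Lemma segint_add F G p q a b : seg_ok F p q a b -> seg_ok G p q a b ->
  segint (fun w => F w + G w)%C p q a b = (segint F p q a b + segint G p q a b)%C.
Proof.
move=> /seg_integrable HF /seg_integrable HG.
by rewrite /segint CInt_add //; ring.
Qed.

Lemma segint_scal F k p q a b : seg_ok F p q a b ->
  segint (fun w => k * F w)%C p q a b = (k * segint F p q a b)%C.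
Proof. by move=> /seg_integrable HF; rewrite /segint CInt_scal //; ring. Qed.

Lemma segint_norm_le F p q a b M : seg_ok F p q a b ->
  (forall t, a <= t <= b -> Cnorm (F (seg p q t)) <= M) ->
  Cnorm (segint F p q a b) <= 2 * M * (b - a).
Proof.
move=> Hok H; have [Hab Hq _] := Hok.
rewrite /segint Cnorm_mul Hq Rmult_1_l.
by apply: CInt_norm_le => //; exact: seg_integrable.
Qed.

Lemma segint_Chasles F p q a m b : a <= m <= b -> seg_ok F p q a b ->
  segint F p q a b = (segint F p q a m + segint F p q m b)%C.
Proof.
move=> Hm [Hab Hq H].
have [u1 u2] : Cintegrable (fun t => F (seg p q t)) a m.
  by apply: seg_integrable; split=> // [|t Ht]; [lra | apply: H; lra].
have [v1 v2] : Cintegrable (fun t => F (seg p q t)) m b.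
  by apply: seg_integrable; split=> // [|t Ht]; [lra | apply: H; lra].
rewrite /segint.
have -> : CInt (fun t => F (seg p q t)) a b =
  (CInt (fun t => F (seg p q t)) a m + CInt (fun t => F (seg p q t)) m b)%C.
  rewrite /CInt; apply C_ext => /=; symmetry.
  - exact: (@RInt_Chasles R_CompleteNormedModule).
  - exact: (@RInt_Chasles R_CompleteNormedModule).
ring.
Qed.

Lemma RInt_affine (k m a b : R) :
  RInt (fun t => k + m * t) a b = k * (b - a) + m * (b * b - a * a) / 2.
Proof.
apply: is_RInt_unique.
have -> : k * (b - a) + m * (b * b - a * a) / 2 =
  minus (k * b + m * (b * b) / 2) (k * a + m * (a * a) / 2).
  by rewrite /minus /plus /opp /=; field.
apply: (@is_RInt_derive R_CompleteNormedModule (fun t => k * t + m * (t * t) / 2)).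
  by move=> t _; auto_derive => //; field.
move=> t _; apply: (proj1 (continuity_pt_filterlim (fun s => k + m * s) t)).
by apply: derivable_continuous_pt; reg.
Qed.

(** The right side is the increment of the primitive [A w + B w^2 / 2] between the endpoints; around
    a closed rectangle it telescopes to 0. *)
Lemma segint_affine (A B p q : C) a b :
  segint (fun w => A + B * w)%C p q a b =
  ((A * seg p q b + B * (seg p q b * seg p q b) * RtoC (/ 2))
   - (A * seg p q a + B * (seg p q a * seg p q a) * RtoC (/ 2)))%C.
Proof.
rewrite /segint.
have -> : CInt (fun t => A + B * seg p q t)%C a b =
  ((A + B * p) * RtoC (b - a) + B * q * RtoC ((b * b - a * a) / 2))%C.
  rewrite /CInt; apply C_ext => /=.
  - rewrite (RInt_extR _ (fun t => fst (A + B * p)%C + fst (B * q)%C * t)); last first.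
      by move=> t /=; ring.
    by rewrite RInt_affine /=; field.
  - rewrite (RInt_extR _ (fun t => snd (A + B * p)%C + snd (B * q)%C * t)); last first.
      by move=> t /=; ring.
    by rewrite RInt_affine /=; field.
by rewrite /seg; apply C_ext => /=; field.
Qed.

(** * Goursat's lemma *)

Definition Ci : C := (0, 1).

(** Counterclockwise boundary integral of [[a,b] x [c,d]]: the top and left edges are run backwards,
    hence the minus signs. Each edge is parametrized by its own moving coordinate, so cutting a
    rectangle is cutting an interval. *)
Definition rectint (F : C -> C) (a b c d : R) : C :=
  (segint F (0, c) C1 a b + segint F (b, 0) Ci c d
   - segint F (0, d) C1 a b - segint F (a, 0) Ci c d)%C.

Lemma seg_h c t : seg (0, c) C1 t = (t, c).
Proof. by rewrite /seg; apply C_ext => /=; ring. Qed.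

Lemma seg_v a t : seg (a, 0) Ci t = (a, t).
Proof. by rewrite /seg; apply C_ext => /=; ring. Qed.

Lemma Cnorm_Ci : Cnorm Ci = 1.
Proof. rewrite CnormE; exact: Complex.Cmod_Ci. Qed.

Lemma seg_ok_h F c a b : a <= b -> (forall t, a <= t <= b -> cdiff F (t, c)) ->
  seg_ok F (0, c) C1 a b.
Proof. by move=> Hab H; split=> // [|t Ht]; [exact: Cnorm1 | rewrite seg_h; exact: H]. Qed.

Lemma seg_ok_v F a c d : c <= d -> (forall t, c <= t <= d -> cdiff F (a, t)) ->
  seg_ok F (a, 0) Ci c d.
Proof. by move=> Hab H; split=> // [|t Ht]; [exact: Cnorm_Ci | rewrite seg_v; exact: H]. Qed.

(** Conditions are imposed on the boundary only, because the Cauchy integrands have a pole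
    inside. *)
Definition on_frame (P : C -> Prop) (a b c d : R) : Prop :=
  (forall t, a <= t <= b -> P (t, c) /\ P (t, d)) /\
  (forall t, c <= t <= d -> P (a, t) /\ P (b, t)).

Lemma on_frame_rect (P : C -> Prop) a b c d : a <= b -> c <= d ->
  (forall x y, a <= x <= b -> c <= y <= d -> P (x, y)) -> on_frame P a b c d.
Proof. by move=> Hab Hcd H; split=> t Ht; split; apply: H; lra. Qed.

Lemma on_frame_imp (P Q : C -> Prop) a b c d : (forall z, P z -> Q z) ->
  on_frame P a b c d -> on_frame Q a b c d.
Proof.
by move=> H [H1 H2]; split=> t Ht; [have [] := H1 t Ht | have [] := H2 t Ht];
  split; apply: H.
Qed.

Lemma rectint_add F G a b c d : a <= b -> c <= d ->
  on_frame (cdiff F) a b c d -> on_frame (cdiff G) a b c d ->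
  rectint (fun w => F w + G w)%C a b c d = (rectint F a b c d + rectint G a b c d)%C.
Proof.
move=> Hab Hcd [F1 F2] [G1 G2]; rewrite /rectint.
rewrite !segint_add; try ring;
  by [apply: seg_ok_h => // t /F1 [] | apply: seg_ok_h => // t /G1 []
     | apply: seg_ok_v => // t /F2 [] | apply: seg_ok_v => // t /G2 []].
Qed.

Lemma rectint_scal F k a b c d : a <= b -> c <= d -> on_frame (cdiff F) a b c d ->
  rectint (fun w => k * F w)%C a b c d = (k * rectint F a b c d)%C.
Proof.
move=> Hab Hcd [F1 F2]; rewrite /rectint.
rewrite !segint_scal; try ring;
  by [apply: seg_ok_h => // t /F1 [] | apply: seg_ok_v => // t /F2 []].
Qed.

Lemma rectint_norm_le F a b c d M : a <= b -> c <= d ->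
  on_frame (cdiff F) a b c d -> on_frame (fun z => Cnorm (F z) <= M) a b c d ->
  Cnorm (rectint F a b c d) <= 4 * M * ((b - a) + (d - c)).
Proof.
move=> Hab Hcd [F1 F2] [H1 H2]; rewrite /rectint.
have A1 : Cnorm (segint F (0, c) C1 a b) <= 2 * M * (b - a).
  by apply: segint_norm_le => [|t /H1 []]; [apply: seg_ok_h => // t /F1 [] | rewrite seg_h].
have A2 : Cnorm (segint F (0, d) C1 a b) <= 2 * M * (b - a).
  by apply: segint_norm_le => [|t /H1 []]; [apply: seg_ok_h => // t /F1 [] | rewrite seg_h].
have A3 : Cnorm (segint F (a, 0) Ci c d) <= 2 * M * (d - c).
  by apply: segint_norm_le => [|t /H2 []]; [apply: seg_ok_v => // t /F2 [] | rewrite seg_v].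
have A4 : Cnorm (segint F (b, 0) Ci c d) <= 2 * M * (d - c).
  by apply: segint_norm_le => [|t /H2 []]; [apply: seg_ok_v => // t /F2 [] | rewrite seg_v].
apply: Rle_trans (Cnorm_sub _ _) _.
apply: Rle_trans (Rplus_le_compat_r _ _ _ (Cnorm_sub _ _)) _.
apply: Rle_trans (Rplus_le_compat_r _ _ _ (Rplus_le_compat_r _ _ _ (Cnorm_triangle _ _))) _.
lra.
Qed.

Lemma rectint_affine A B a b c d : rectint (fun w => A + B * w)%C a b c d = C0.
Proof. by rewrite /rectint !segint_affine !seg_h !seg_v; ring. Qed.

Lemma rectint_split_x F a m b c d : a <= m <= b ->
  (forall t, a <= t <= b -> cdiff F (t, c) /\ cdiff F (t, d)) ->
  rectint F a b c d = (rectint F a m c d + rectint F m b c d)%C.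
Proof.
move=> Hm H; rewrite /rectint.
rewrite (segint_Chasles F (0, c) C1 a m b) //; last by apply: seg_ok_h => [|t /H []] //; lra.
rewrite (segint_Chasles F (0, d) C1 a m b) //; last by apply: seg_ok_h => [|t /H []] //; lra.
ring.
Qed.

Lemma rectint_split_y F a b c m d : c <= m <= d ->
  (forall t, c <= t <= d -> cdiff F (a, t) /\ cdiff F (b, t)) ->
  rectint F a b c d = (rectint F a b c m + rectint F a b m d)%C.
Proof.
move=> Hm H; rewrite /rectint.
rewrite (segint_Chasles F (a, 0) Ci c m d) //; last by apply: seg_ok_v => [|t /H []] //; lra.
rewrite (segint_Chasles F (b, 0) Ci c m d) //; last by apply: seg_ok_v => [|t /H []] //; lra.
ring.
Qed.

(** [P n x y] speaks of the generation [n] rectangle with lower left corner [(x, y)] and sides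
    [W / 2^n], [H / 2^n]. If [P] failed at the start, some quarter would fail at every stage; the
    nested failing rectangles share a point, and locality of [P] at that point is a
    contradiction. *)
Lemma bisection_principle (P : nat -> R -> R -> Prop) (a c W H : R) :
  0 <= W -> 0 <= H ->
  (forall n x y, let w := W / 2 ^ n.+1 in let h := H / 2 ^ n.+1 in
     P n.+1 x y -> P n.+1 (x + w) y -> P n.+1 x (y + h) -> P n.+1 (x + w) (y + h) ->
     P n x y) ->
  (forall p q, a <= p <= a + W -> c <= q <= c + H -> exists n, forall x y,
     x <= p <= x + W / 2 ^ n -> y <= q <= y + H / 2 ^ n -> P n x y) ->
  P 0%N a c.
Proof.
move=> HW HH Hstep Hloc; case: (classic (P 0%N a c)) => // Hnot.
have half (X : R) (n : nat) : X / 2 ^ n = X / 2 ^ n.+1 + X / 2 ^ n.+1.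
  by rewrite -tech_pow_Rmult; field; apply: pow_nonzero; lra.
have pos (X : R) (n : nat) : 0 <= X -> 0 <= X / 2 ^ n.
  by move=> HX; apply: Rmult_le_pos => //; left; apply: Rinv_0_lt_compat; apply: pow_lt; lra.
(* A successor corner exists for every [s], also when [P] holds there (failure is then inherited
   vacuously), so that a total choice function can be iterated. *)
have ex n (s : R * R) : exists s' : R * R,
    fst s <= fst s' <= fst s + W / 2 ^ n.+1 /\ snd s <= snd s' <= snd s + H / 2 ^ n.+1 /\
    (~ P n (fst s) (snd s) -> ~ P n.+1 (fst s') (snd s')).
  have := pos W n.+1 HW; have := pos H n.+1 HH; have := Hstep n (fst s) (snd s).
  move: (W / 2 ^ n.+1) (H / 2 ^ n.+1) => w h; case: s => x y /= Hs h0 w0.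
  case: (classic (P n.+1 x y)) => [P1|N1]; last by exists (x, y) => /=; do ?split=> //; lra.
  case: (classic (P n.+1 (x + w) y)) => [P2|N1]; last first.
    by exists (x + w, y) => /=; do ?split=> //; lra.
  case: (classic (P n.+1 x (y + h))) => [P3|N1]; last first.
    by exists (x, y + h) => /=; do ?split=> //; lra.
  case: (classic (P n.+1 (x + w) (y + h))) => [P4|N1]; last first.
    by exists (x + w, y + h) => /=; do ?split=> //; lra.
  by exists (x, y) => /=; do ?split; try lra; move=> N; case: N; exact: Hs.
pose f n s := proj1_sig (constructive_indefinite_description _ (ex n s)).
have fP n s := proj2_sig (constructive_indefinite_description _ (ex n s)).
pose S := fix S n := match n with O => (a, c) | S m => f m (S m) end.
have SP n : fst (S n) <= fst (S n.+1) <= fst (S n) + W / 2 ^ n.+1 /\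
    snd (S n) <= snd (S n.+1) <= snd (S n) + H / 2 ^ n.+1 /\
    (~ P n (fst (S n)) (snd (S n)) -> ~ P n.+1 (fst (S n.+1)) (snd (S n.+1))).
  exact: fP.
have SN n : ~ P n (fst (S n)) (snd (S n)).
  by elim: n => [//|n IH]; have [_ [_]] := SP n; exact.
have nested (u : nat -> R) (X : R) : 0 <= X ->
    (forall n, u n <= u n.+1 <= u n + X / 2 ^ n.+1) ->
    exists p, forall n, u n <= p <= u n + X / 2 ^ n.
  move=> HX Hu.
  have up n k : u n <= u (n + k)%N.
    elim: k => [|k IH]; first by rewrite addn0; lra.
    by rewrite addnS; have := Hu (n + k)%N; lra.
  have dn n k : u (n + k)%N + X / 2 ^ (n + k) <= u n + X / 2 ^ n.
    elim: k => [|k IH]; first by rewrite addn0; lra.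
    by rewrite addnS; have := Hu (n + k)%N; have := half X (n + k)%N; lra.
  have le m n : u m <= u n + X / 2 ^ n.
    have := up m n; have := dn n m; have := pos X (n + m)%N HX; rewrite (addnC n m); lra.
  (* The common point is the supremum of the left endpoints; by [le] each right endpoint is an upper
     bound. *)
  have [||p [Hp1 Hp2]] := completeness (fun r => exists n, r = u n).
  - by exists (u 0%N + X / 2 ^ 0) => r [n ->]; exact: le.
  - by exists (u 0%N), 0%N.
  exists p => n; split; first by apply: Hp1; exists n.
  by apply: Hp2 => r [m ->]; exact: le.
have [p Hp] := nested (fun n => fst (S n)) W HW (fun n => proj1 (SP n)).
have [q Hq] := nested (fun n => snd (S n)) H HH (fun n => proj1 (proj2 (SP n))).
have [||n Hn] := Hloc p q.
- by have := Hp 0%N => /=; lra.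
- by have := Hq 0%N => /=; lra.
by case: (SN n); exact: Hn.
Qed.

Lemma pow2_small (X d : R) : 0 <= X -> 0 < d -> exists n, X / 2 ^ n < d.
Proof.
move=> HX Hd.
have [n Hn] := Pow_x_infinity 2 ltac:(rewrite Rabs_pos_eq; lra) ((X + 1) / d).
exists n; have := Hn n (le_n n).
have H2 : 0 < 2 ^ n by apply: pow_lt; lra.
rewrite Rabs_pos_eq; last lra.
move=> /Rge_le H.
have : (X + 1) / d * d <= 2 ^ n * d by apply: Rmult_le_compat_r; lra.
have -> : (X + 1) / d * d = X + 1 by field; lra.
move=> H3; apply: (Rmult_lt_reg_r (2 ^ n)) => //.
have -> : X / 2 ^ n * 2 ^ n = X by field; lra.
lra.
Qed.

(** Bisection with a bound quadratic in the side lengths: four quarters add up exactly to the bound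
    for the whole. On a small rectangle the affine part of [F] integrates to 0, while the remainder
    is at most [eps * (w + h)] on a frame of length [2 * (w + h)]. *)
Theorem Goursat (F : C -> C) a b c d : a <= b -> c <= d ->
  (forall x y, a <= x <= b -> c <= y <= d -> cdiff F (x, y)) ->
  rectint F a b c d = C0.
Proof.
move=> Hab Hcd HF.
set W := b - a; set H := d - c.
have W0 : 0 <= W by rewrite /W; lra.
have H0 : 0 <= H by rewrite /H; lra.
have pw n : 0 < 2 ^ n by apply: pow_lt; lra.
have pos (X : R) (n : nat) : 0 <= X -> 0 <= X / 2 ^ n.
  by move=> HX; apply: Rmult_le_pos => //; left; apply: Rinv_0_lt_compat.
have half (X : R) (n : nat) : X / 2 ^ n = X / 2 ^ n.+1 + X / 2 ^ n.+1.
  by rewrite -tech_pow_Rmult; field; apply: pow_nonzero; lra.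
suff key eps : 0 < eps -> Cnorm (rectint F a b c d) <= eps * (4 * (W + H) * (W + H)).
  apply: Cnorm_eq0; apply: Rle_antisym; last exact: Cnorm_ge0.
  apply: Rnot_lt_le => Hlt.
  set S := 4 * (W + H) * (W + H).
  have S0 : 0 <= S by rewrite /S; apply: Rmult_le_pos; [apply: Rmult_le_pos|]; lra.
  set N := Cnorm _ in Hlt.
  have := key (N / (2 * (S + 1))) ltac:(apply: Rdiv_lt_0_compat; lra).
  rewrite -/N -/S => K.
  have E : N / (2 * (S + 1)) * (S + 1) = N / 2 by field; lra.
  have : 0 < N / (2 * (S + 1)) by apply: Rdiv_lt_0_compat; lra.
  lra.
move=> He.
pose P n x y := a <= x -> x + W / 2 ^ n <= b -> c <= y -> y + H / 2 ^ n <= d ->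
  Cnorm (rectint F x (x + W / 2 ^ n) y (y + H / 2 ^ n))
    <= eps * (4 * ((W + H) / 2 ^ n) * ((W + H) / 2 ^ n)).
suff : P 0%N a c.
  rewrite /P /= !Rdiv_1_r.
  have -> : a + W = b by rewrite /W; lra.
  have -> : c + H = d by rewrite /H; lra.
  apply; lra.
apply: (bisection_principle P a c W H W0 H0) => [n x y w h|p q Hp Hq].
  rewrite /P -/w -/h (half W n) (half H n) (half (W + H) n) -/w -/h.
  have w0 := pos W n.+1 W0; have h0 := pos H n.+1 H0; rewrite -/w -/h in w0 h0.
  have -> : (W + H) / 2 ^ n.+1 = w + h by rewrite /w /h; field; apply: pow_nonzero; lra.
  set t := w + h.
  move=> A1 A2 A3 A4 B1 B2 B3 B4.
  have {}A1 := A1 ltac:(lra) ltac:(lra) ltac:(lra) ltac:(lra).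
  have {}A2 := A2 ltac:(lra) ltac:(lra) ltac:(lra) ltac:(lra).
  have {}A3 := A3 ltac:(lra) ltac:(lra) ltac:(lra) ltac:(lra).
  have {}A4 := A4 ltac:(lra) ltac:(lra) ltac:(lra) ltac:(lra).
  rewrite (rectint_split_x F x (x + w)); [|lra|by move=> s Hs; split; apply: HF; lra].
  rewrite (rectint_split_y F x (x + w) y (y + h)); [|lra|by move=> s Hs; split; apply: HF; lra].
  rewrite (rectint_split_y F (x + w) _ y (y + h)); [|lra|by move=> s Hs; split; apply: HF; lra].
  rewrite -!(Rplus_assoc x) -!(Rplus_assoc y).
  apply: Rle_trans (Cnorm_triangle _ _) _.
  have T1 := Cnorm_triangle (rectint F x (x + w) y (y + h)) (rectint F x (x + w) (y + h) (y + h + h)).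
  have T2 := Cnorm_triangle (rectint F (x + w) (x + w + w) y (y + h))
    (rectint F (x + w) (x + w + w) (y + h) (y + h + h)).
  lra.
have [D HD] := HF p q ltac:(rewrite /W in Hp; lra) ltac:(rewrite /H in Hq; lra).
have [del [Hdel Hd]] := HD eps He.
have [n Hn] := pow2_small (W + H) del ltac:(lra) Hdel.
exists n => x y Hx Hy B1 B2 B3 B4.
set w := W / 2 ^ n in Hx B2 *; set h := H / 2 ^ n in Hy B4 *.
have w0 : 0 <= w by exact: pos.
have h0 : 0 <= h by exact: pos.
have E : (W + H) / 2 ^ n = w + h by rewrite /w /h; field; apply: pow_nonzero; lra.
rewrite E in Hn *.
pose z0 : C := (p, q).
pose A := (F z0 - D * z0)%C.
(* [A + D * w] is the first-order approximation of [F] at [z0]. Subtracting it does not change the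
   integral and leaves only the small remainder. *)
pose r := fun w => (F w + (- C1) * (A + D * w))%C.
have afd (z : C) : cdiff (fun w => A + D * w)%C z.
  by apply: cdiff_add; [exact: cdiff_const | apply: cdiff_scal; exact: cdiff_id].
have frF : on_frame (cdiff F) x (x + w) y (y + h).
  by apply: on_frame_rect; [lra|lra|move=> s t Hs Ht; apply: HF; lra].
have fra : on_frame (cdiff (fun w => A + D * w)%C) x (x + w) y (y + h).
  by apply: on_frame_rect; [lra|lra|move=> s t Hs Ht; exact: afd].
have fra' : on_frame (cdiff (fun w => - C1 * (A + D * w))%C) x (x + w) y (y + h).
  by apply: on_frame_imp fra => z; exact: cdiff_scal.
have -> : rectint F x (x + w) y (y + h) = rectint r x (x + w) y (y + h).
  rewrite /r rectint_add //; try lra.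
  by rewrite rectint_scal //; try lra; rewrite rectint_affine; ring.
have := rectint_norm_le r x (x + w) y (y + h) (eps * (w + h)) ltac:(lra) ltac:(lra).
have -> : 4 * (eps * (w + h)) * (x + w - x + (y + h - y)) = eps * (4 * (w + h) * (w + h)) by ring.
apply.
  by apply: on_frame_rect => [||s t Hs Ht]; try lra;
    apply: cdiff_add; [apply: HF; lra | apply: cdiff_scal; exact: afd].
apply: on_frame_rect => [||s t Hs Ht]; try lra.
have Hu : Cnorm ((s, t) - z0)%C <= w + h.
  apply: Rle_trans (Cnorm_le_sum _) _ => /=.
  have : Rabs (s + - p) <= w by apply: Rabs_le; lra.
  by have : Rabs (t + - q) <= h by [apply: Rabs_le; lra]; lra.
have := Hd ((s, t) - z0)%C ltac:(lra).
rewrite -/z0.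
have -> : (z0 + ((s, t) - z0) = (s, t))%C by ring.
have -> : (F (s, t) - F z0 - D * ((s, t) - z0) = r (s, t))%C by rewrite /r /A; ring.
move=> K; apply: Rle_trans K _.
by apply: Rmult_le_compat_l => //; lra.
Qed.

(** * Cauchy's formula on a square, and differentiability of derivatives *)

(** Two vertical and two horizontal cuts remove four strips around the small square. On each strip
    one coordinate stays away from that of [(p, q)], so Goursat's lemma applies there. *)
Lemma rectint_shrink F (p q e a b c d : R) : 0 < e ->
  a <= p - e -> p + e <= b -> c <= q - e -> q + e <= d ->
  (forall x y, a <= x <= b -> c <= y <= d -> (x, y) <> (p, q) -> cdiff F (x, y)) ->
  rectint F a b c d = rectint F (p - e) (p + e) (q - e) (q + e).
Proof.
move=> He Ha Hb Hc Hd HF.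
have HFx x y : a <= x <= b -> c <= y <= d -> x <> p -> cdiff F (x, y).
  by move=> Hx Hy N; apply: HF => // [[E _]].
have HFy x y : a <= x <= b -> c <= y <= d -> y <> q -> cdiff F (x, y).
  by move=> Hx Hy N; apply: HF => // [[_ E]].
rewrite (rectint_split_x F a (p - e)); [|lra|by move=> t Ht; split; apply: HFy; lra].
rewrite (Goursat F a (p - e)); [|lra|lra|by move=> x y Hx Hy; apply: HFx; lra].
rewrite (rectint_split_x F (p - e) (p + e)); [|lra|by move=> t Ht; split; apply: HFy; lra].
rewrite (Goursat F (p + e) b); [|lra|lra|by move=> x y Hx Hy; apply: HFx; lra].
rewrite (rectint_split_y F _ _ c (q - e)); [|lra|by move=> t Ht; split; apply: HFx; lra].
rewrite (Goursat F _ _ c (q - e)); [|lra|lra|by move=> x y Hx Hy; apply: HFy; lra].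
rewrite (rectint_split_y F _ _ (q - e) (q + e)); [|lra|by move=> t Ht; split; apply: HFx; lra].
rewrite (Goursat F _ _ (q + e) d); [|lra|lra|by move=> x y Hx Hy; apply: HFy; lra].
ring.
Qed.

Lemma RInt_atan (p e : R) : 0 < e ->
  RInt (fun t => e / ((t - p) * (t - p) + e * e)) (p - e) (p + e) = PI / 2.
Proof.
move=> He; apply: is_RInt_unique.
have -> : PI / 2 = minus (atan ((p + e - p) / e)) (atan ((p - e - p) / e)).
  have -> : (p + e - p) / e = 1 by field; lra.
  have -> : (p - e - p) / e = - 1 by field; lra.
  by rewrite atan_opp atan_1 /minus /plus /opp /=; field.
have D0 t : (t - p) * (t - p) + e * e <> 0.
  by have := Rmult_lt_0_compat _ _ He He; have := Rle_0_sqr (t - p); rewrite /Rsqr; lra.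
apply: (@is_RInt_derive R_CompleteNormedModule (fun t => atan ((t - p) / e))).
  move=> t _; auto_derive => //; have := D0 t => H; field.
  by split; lra.
move=> t _.
apply: (proj1 (continuity_pt_filterlim (fun s => e / ((s - p) * (s - p) + e * e)) t)).
by apply: derivable_continuous_pt; reg.
Qed.

(** From its centre each side of the square is seen under a quarter turn, so each edge contributes
    [i * PI / 2]. *)
Lemma rectint_inv (p q e : R) : 0 < e ->
  rectint (fun w => Cinv (w - (p, q)))%C (p - e) (p + e) (q - e) (q + e)
  = (RtoC (2 * PI) * Ci)%C.
Proof.
move=> He; rewrite /rectint /segint.
(* [X] and [Y] are never evaluated: the same value occurs on two opposite edges, which are run in
   opposite directions. *)
set X := RInt (fun t => (t - p) / ((t - p) * (t - p) + e * e)) (p - e) (p + e).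
set Y := RInt (fun t => - (t - q) / ((t - q) * (t - q) + e * e)) (q - e) (q + e).
have D0 s t : (t - s) * (t - s) + e * e <> 0.
  by have := Rmult_lt_0_compat _ _ He He; have := Rle_0_sqr (t - s); rewrite /Rsqr; lra.
have neg s : RInt (fun t => - (e / ((t - s) * (t - s) + e * e))) (s - e) (s + e) = - (PI / 2) :> R.
  rewrite -(RInt_atan s e He).
  rewrite (RInt_extR _ (fun t => (- 1) * (e / ((t - s) * (t - s) + e * e)))).
    rewrite RInt_scalR; first by ring.
    apply: (@ex_RInt_continuous R_CompleteNormedModule) => t _.
    apply: (proj1 (continuity_pt_filterlim (fun u => e / ((u - s) * (u - s) + e * e)) t)).
    by apply: derivable_continuous_pt; reg.
  by move=> t; ring.
have dec (f : R -> C) a b x y : RInt (fun t => fst (f t)) a b = x ->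
  RInt (fun t => snd (f t)) a b = y -> CInt f a b = (x, y) by move=> <- <-.
rewrite (dec _ _ _ X (PI / 2)); first last.
- rewrite -(RInt_atan p e He); apply: RInt_extR => t; rewrite seg_h /=.
  by field; have := D0 p t; do ?split; lra.
- by apply: RInt_extR => t; rewrite seg_h /=; field; have := D0 p t; do ?split; lra.
rewrite (dec _ _ _ (PI / 2) Y); first last.
- by apply: RInt_extR => t; rewrite seg_v /=; field; have := D0 q t; do ?split; lra.
- rewrite -(RInt_atan q e He); apply: RInt_extR => t; rewrite seg_v /=.
  by field; have := D0 q t; do ?split; lra.
rewrite (dec _ _ _ X (- (PI / 2))); first last.
- rewrite -(neg p); apply: RInt_extR => t; rewrite seg_h /=.
  by field; have := D0 p t; do ?split; lra.
- by apply: RInt_extR => t; rewrite seg_h /=; field; have := D0 p t; do ?split; lra.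
rewrite (dec _ _ _ (- (PI / 2)) Y); first last.
- by apply: RInt_extR => t; rewrite seg_v /=; field; have := D0 q t; do ?split; lra.
- rewrite -(neg q); apply: RInt_extR => t; rewrite seg_v /=.
  by field; have := D0 q t; do ?split; lra.
by apply C_ext => /=; field.
Qed.

(** After shrinking to a square of half side [e] around [z], the difference of the two sides is the
    integral of [(h w - h z) / (w - z)]. This quotient stays bounded by [1 + Cnorm D] near [z], so
    the integral is [O(e)]. *)
Lemma Cauchy_formula (h : C -> C) (p q a b c d : R) :
  a < p < b -> c < q < d ->
  (forall x y, a <= x <= b -> c <= y <= d -> cdiff h (x, y)) ->
  rectint (fun w => h w * Cinv (w - (p, q)))%C a b c d
  = (h (p, q) * (RtoC (2 * PI) * Ci))%C.
Proof.
move=> Hp Hq Hh.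
set z : C := (p, q).
have Hk x y : a <= x <= b -> c <= y <= d -> (x, y) <> z ->
    cdiff (fun w => h w * Cinv (w - z))%C (x, y).
  by move=> Hx Hy N; apply: cdiff_mul; [exact: Hh | exact: cdiff_inv_sub].
set I := rectint _ _ _ _ _; set J := (_ * _)%C.
suff K : Cnorm (I - J)%C = 0.
  by have -> : I = (I - J + J)%C by [ring]; rewrite (Cnorm_eq0 _ K); ring.
apply: Rle_antisym; last exact: Cnorm_ge0.
apply: Rnot_lt_le => Hlt; set n := Cnorm _ in Hlt.
have [D HD] := Hh p q ltac:(lra) ltac:(lra).
have [del [Hdel Hd]] := HD 1 Rlt_0_1.
have D0 := Cnorm_ge0 D.
set B := 1 + Cnorm D.
set m1 := Rmin (Rmin (p - a) (b - p)) (Rmin (q - c) (d - q)).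
have m1p : 0 < m1 by do 2 apply: Rmin_glb_lt; lra.
(* [m1 / 2] keeps the square inside the rectangle; [del / 4] keeps its frame, at distance at most
   [2 * e], where the derivative estimate holds; [n / (32 * B)] makes the bound [16 * B * e] at most
   [n / 2], contradicting [n > 0]. *)
set e := Rmin (m1 / 2) (Rmin (del / 4) (n / (32 * B))).
have e0 : 0 < e.
  by do 2 (apply: Rmin_glb_lt; first lra); apply: Rdiv_lt_0_compat; rewrite /B; lra.
have e1 : e <= m1 / 2 by exact: Rmin_l.
have e2 : e <= del / 4 by apply: Rle_trans (Rmin_r _ _) (Rmin_l _ _).
have e3 : e <= n / (32 * B) by apply: Rle_trans (Rmin_r _ _) (Rmin_r _ _).
have m1a : m1 <= p - a by apply: Rle_trans (Rmin_l _ _) (Rmin_l _ _).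
have m1b : m1 <= b - p by apply: Rle_trans (Rmin_l _ _) (Rmin_r _ _).
have m1c : m1 <= q - c by apply: Rle_trans (Rmin_r _ _) (Rmin_l _ _).
have m1d : m1 <= d - q by apply: Rle_trans (Rmin_r _ _) (Rmin_r _ _).
have fr (P : C -> Prop) : (forall x y, p - e <= x <= p + e -> q - e <= y <= q + e ->
    e <= Cnorm ((x, y) - z)%C -> P (x, y)) -> on_frame P (p - e) (p + e) (q - e) (q + e).
  move=> HP.
  have f1 (w : C) : e <= Rabs (fst w) -> e <= Cnorm w.
    by move=> H; apply: Rle_trans H (fst_le_Cnorm w).
  have f2 (w : C) : e <= Rabs (snd w) -> e <= Cnorm w.
    by move=> H; apply: Rle_trans H (snd_le_Cnorm w).
  split=> t Ht; split; apply: HP; try lra.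
  - by apply: f2 => /=; rewrite Rabs_left; lra.
  - by apply: f2 => /=; rewrite Rabs_right; lra.
  - by apply: f1 => /=; rewrite Rabs_left; lra.
  - by apply: f1 => /=; rewrite Rabs_right; lra.
have nz (w : C) : e <= Cnorm (w - z)%C -> w <> z.
  move=> H E; move: H; rewrite E.
  by have -> : (z - z = C0)%C by [ring]; rewrite Cnorm0; lra.
have IE : I = rectint (fun w => h w * Cinv (w - z))%C (p - e) (p + e) (q - e) (q + e).
  by apply: rectint_shrink => //; lra.
have JE : J = (h z * rectint (fun w => Cinv (w - z))%C (p - e) (p + e) (q - e) (q + e))%C.
  by rewrite rectint_inv.
pose r w := (h w * Cinv (w - z) + (- C1 * h z) * Cinv (w - z))%C.
have c1 : on_frame (cdiff (fun w => h w * Cinv (w - z))%C) (p - e) (p + e) (q - e) (q + e).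
  by apply: fr => x y Hx Hy /nz N; apply: Hk => //; lra.
have c2 : on_frame (cdiff (fun w => Cinv (w - z))%C) (p - e) (p + e) (q - e) (q + e).
  by apply: fr => x y Hx Hy /nz N; exact: cdiff_inv_sub.
have c3 : on_frame (cdiff (fun w => - C1 * h z * Cinv (w - z))%C) (p - e) (p + e) (q - e) (q + e).
  by apply: on_frame_imp c2 => w; exact: cdiff_scal.
have RE : (I - J = rectint r (p - e) (p + e) (q - e) (q + e))%C.
  rewrite /r rectint_add //; try lra.
  by rewrite rectint_scal //; try lra; rewrite IE JE; ring.
have := rectint_norm_le r (p - e) (p + e) (q - e) (q + e) B ltac:(lra) ltac:(lra).
rewrite -RE -/n => H; suff : n <= 16 * B * e.
  have : 16 * B * e <= 16 * B * (n / (32 * B)) by apply: Rmult_le_compat_l => //; rewrite /B; lra.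
  have -> : 16 * B * (n / (32 * B)) = n / 2 by field; rewrite /B; lra.
  lra.
have -> : 16 * B * e = 4 * B * (p + e - (p - e) + (q + e - (q - e))) by ring.
apply: H.
  apply: fr => x y Hx Hy /nz N; rewrite /r; apply: cdiff_add; first by apply: Hk => //; lra.
  by apply: cdiff_scal; exact: cdiff_inv_sub.
apply: fr => x y Hx Hy Hn.
set u := ((x, y) - z)%C in Hn *.
have u0 : 0 < Cnorm u by lra.
have uN := Cnorm_neq0 _ u0.
have Hu : Cnorm u < del.
  apply: Rle_lt_trans (Cnorm_le_sum _) _ => /=.
  have : Rabs (x + - p) <= e by apply: Rabs_le; lra.
  by have : Rabs (y + - q) <= e by [apply: Rabs_le; lra]; lra.
have {}Hd := Hd u Hu.
have Hz : (z + u = (x, y))%C by rewrite /u; ring.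
rewrite -/z Hz in Hd.
have -> : r (x, y) = ((h (x, y) - h z - D * u) * Cinv u + D)%C.
  by rewrite /r -/u; field.
apply: Rle_trans (Cnorm_triangle _ _) _; rewrite Cnorm_mul Cnorm_inv //.
apply: Rplus_le_compat_r.
apply: (Rmult_le_reg_r (Cnorm u)) => //.
by rewrite Rmult_assoc Rinv_l; lra.
Qed.

(** * Differentiation of Cauchy integrals in the position of the pole *)

(** Differentiation under the integral sign. A second-order remainder uniform along the segment
    survives integration as [O(Cnorm u ^ 2)], so no continuity of [G1] in its second argument
    enters. *)
Lemma segint_param (G G1 : C -> C -> C) (p q : C) (a b : R) (z : C) (del M : R) :
  0 < del -> 0 <= M ->
  (forall u, Cnorm u < del -> seg_ok (fun w => G w (z + u)%C) p q a b) ->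
  seg_ok (fun w => G1 w z) p q a b ->
  (forall u t, Cnorm u < del -> a <= t <= b ->
    Cnorm (G (seg p q t) (z + u) - G (seg p q t) z - G1 (seg p q t) z * u)%C
      <= M * (Cnorm u * Cnorm u)) ->
  has_cderiv (fun v => segint (fun w => G w v) p q a b) z (segint (fun w => G1 w z) p q a b).
Proof.
move=> Hdel HM HG HG1 HE eps He.
have [Hab Hq HD1] := HG1.
have HG0 : seg_ok (fun w => G w z) p q a b.
  have := HG C0; rewrite Cnorm0; have -> : (z + C0)%C = z by ring.
  exact.
have [_ _ HD0] := HG0.
(* The summand 1 keeps [K] positive when [M] or [b - a] vanishes. *)
set K := 2 * M * (b - a) + 1.
have K0 : 0 < K.
  by rewrite /K; have := Rmult_le_pos _ _ HM (_ : 0 <= b - a); lra.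
exists (Rmin del (eps / K)); split.
  by apply: Rmin_glb_lt => //; apply: Rdiv_lt_0_compat.
move=> u Hu.
have u1 : Cnorm u < del by apply: Rlt_le_trans Hu (Rmin_l _ _).
have u2 : Cnorm u < eps / K by apply: Rlt_le_trans Hu (Rmin_r _ _).
have [_ _ HDu] := HG u u1.
have u0 := Cnorm_ge0 u.
pose r w := (G w (z + u) + ((- C1) * G w z + (- u) * G1 w z))%C.
have ok2 : seg_ok (fun w => (- C1) * G w z + (- u) * G1 w z)%C p q a b.
  by split=> // t Ht; apply: cdiff_add; apply: cdiff_scal; [exact: HD0 | exact: HD1].
have okr : seg_ok r p q a b.
  by split=> // t Ht; apply: cdiff_add; [exact: HDu | case: ok2 => _ _; exact].
have -> : (segint (fun w => G w (z + u)) p q a b - segint (fun w => G w z) p q a b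
    - segint (fun w => G1 w z) p q a b * u = segint r p q a b)%C.
  rewrite /r segint_add //.
  rewrite segint_add; first by rewrite !segint_scal //; ring.
  - by split=> // t Ht; apply: cdiff_scal; exact: HD0.
  - by split=> // t Ht; apply: cdiff_scal; exact: HD1.
have B : Cnorm (segint r p q a b) <= 2 * (M * (Cnorm u * Cnorm u)) * (b - a).
  apply: segint_norm_le => // t Ht; apply: Rle_trans (HE u t u1 Ht).
  by right; congr Cnorm; rewrite /r; ring.
apply: Rle_trans B _.
have -> : 2 * (M * (Cnorm u * Cnorm u)) * (b - a) = (K - 1) * Cnorm u * Cnorm u by rewrite /K; ring.
apply: Rmult_le_compat_r => //.
have : K * Cnorm u <= K * (eps / K) by apply: Rmult_le_compat_l; lra.
have -> : K * (eps / K) = eps by field; lra.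
lra.
Qed.

Lemma seg_bounded F p q a b : seg_ok F p q a b ->
  exists M, 0 <= M /\ forall t, a <= t <= b -> Cnorm (F (seg p q t)) <= M.
Proof.
move=> [Hab Hq HF].
have [|x [Hx _]] := continuity_ab_maj (fun t => Rabs (fst (F (seg p q t)))) a b Hab.
  move=> t Ht; apply: (continuity_pt_comp (fun t => fst (F (seg p q t))) Rabs).
    by apply/continuity_pt_filterlim; exact: (proj1 (seg_continuity F p q t Hq (HF t Ht))).
  exact: Rcontinuity_abs.
have [|y [Hy _]] := continuity_ab_maj (fun t => Rabs (snd (F (seg p q t)))) a b Hab.
  move=> t Ht; apply: (continuity_pt_comp (fun t => snd (F (seg p q t))) Rabs).
    by apply/continuity_pt_filterlim; exact: (proj2 (seg_continuity F p q t Hq (HF t Ht))).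
  exact: Rcontinuity_abs.
exists (Rabs (fst (F (seg p q x))) + Rabs (snd (F (seg p q y)))); split.
  by apply: Rplus_le_le_0_compat; exact: Rabs_pos.
move=> t Ht; apply: Rle_trans (Cnorm_le_sum _) _.
by have := Hx t Ht; have := Hy t Ht; lra.
Qed.

Section CauchyKernel.
Variables (F : C -> C) (p q z : C) (a b del : R).
Hypothesis (Hdel : 0 < del) (HF : seg_ok F p q a b).
Hypothesis Hsep : forall t, a <= t <= b -> del <= Cnorm (seg p q t - z)%C.

Let sep (u : C) t : Cnorm u < del / 2 -> a <= t <= b ->
  del / 2 <= Cnorm (seg p q t - (z + u))%C.
Proof.
move=> Hu Ht; have := Hsep t Ht; have := Cnorm_sub_rev (seg p q t - z)%C u.
have -> : (seg p q t - z - u = seg p q t - (z + u))%C by ring.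
lra.
Qed.

Let nz (u : C) t : Cnorm u < del / 2 -> a <= t <= b -> (seg p q t - (z + u))%C <> C0.
Proof. by move=> Hu Ht; apply: Cnorm_neq0; have := sep u t Hu Ht; lra. Qed.

Let nz0 t : a <= t <= b -> (seg p q t - z)%C <> C0.
Proof. by move=> Ht; apply: Cnorm_neq0; have := Hsep t Ht; lra. Qed.

Let inv_le (w : C) (r : R) : 0 < r -> r <= Cnorm w -> 0 <= Cnorm (Cinv w) <= / r.
Proof.
move=> Hr Hw; rewrite Cnorm_inv; last by apply: Cnorm_neq0; lra.
split; first by left; apply: Rinv_0_lt_compat; lra.
exact: Rinv_le_contravar.
Qed.

Let cdiff_inv u t : Cnorm u < del / 2 -> a <= t <= b ->
  cdiff (fun w => Cinv (w - (z + u)))%C (seg p q t).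
Proof.
move=> Hu Ht; apply: cdiff_inv_sub => E; apply: (nz u t Hu Ht); rewrite E; ring.
Qed.

Let cdiff_inv0 t : a <= t <= b -> cdiff (fun w => Cinv (w - z))%C (seg p q t).
Proof. by move=> Ht; apply: cdiff_inv_sub => E; apply: (nz0 t Ht); rewrite E; ring. Qed.

(** The kernel remainder is exactly [u^2 / ((s - z)^2 (s - z - u))]. [Hsep] bounds the inverse of
    the first factor type by [i]; for [Cnorm u < del / 2] the shifted distance is at least
    [del / 2], which gives [j]. *)
Lemma Cauchy_kernel_deriv1 :
  has_cderiv (fun v => segint (fun w => F w * Cinv (w - v))%C p q a b) z
    (segint (fun w => F w * (Cinv (w - z) * Cinv (w - z)))%C p q a b).
Proof.
have [Hab Hq HD] := HF.
have [M [M0 HM]] := seg_bounded F p q a b HF.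
set i := / del; set j := / (del / 2).
have i0 : 0 < i by apply: Rinv_0_lt_compat.
have j0 : 0 < j by apply: Rinv_0_lt_compat; lra.
apply: (segint_param (fun w v => F w * Cinv (w - v))%C
  (fun w v => F w * (Cinv (w - v) * Cinv (w - v)))%C _ _ _ _ _ (del / 2) (M * (i * i * j))).
- lra.
- by apply: Rmult_le_pos => //; left; do 2 apply: Rmult_lt_0_compat => //.
- by move=> u Hu; split=> // t Ht; apply: cdiff_mul; [exact: HD | exact: cdiff_inv].
- split=> // t Ht; apply: cdiff_mul; first exact: HD.
  by apply: cdiff_mul; exact: cdiff_inv0.
move=> u t Hu Ht.
set s := seg p q t.
have n1 := nz u t Hu Ht; have n2 := nz0 t Ht.
have -> : (F s * Cinv (s - (z + u)) - F s * Cinv (s - z) - F s * (Cinv (s - z) * Cinv (s - z)) * u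
  = F s * (Cinv (s - z) * Cinv (s - z) * Cinv (s - (z + u))) * (u * u))%C.
  by field; split.
rewrite !Cnorm_mul.
have := HM t Ht; have := inv_le _ _ Hdel (Hsep t Ht).
have := inv_le _ (del / 2) ltac:(lra) (sep u t Hu Ht); rewrite -/s -/i -/j.
have := Cnorm_ge0 (F s); have := Cnorm_ge0 u.
set A := Cnorm (F s); set B := Cnorm (Cinv (s - z)%C); set D := Cnorm (Cinv _).
move=> U0 A0 HD' HB HA.
apply: Rmult_le_compat_r; first exact: Rmult_le_pos.
have BB : B * B <= i * i by apply: Rmult_le_compat; lra.
have B0 : 0 <= B * B by apply: Rmult_le_pos; lra.
have BBD : B * B * D <= i * i * j by apply: Rmult_le_compat; lra.
by apply: Rmult_le_compat => //; apply: Rmult_le_pos; lra.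
Qed.

(** With [a = 1 / (s - z)] and [b = 1 / (s - z - u)], the relation [b - a = u a b] used twice gives
    [b^2 - a^2 - 2 u a^3 = u^2 a^2 b (b + 2 a)]. *)
Lemma Cauchy_kernel_deriv2 :
  cdiff (fun v => segint (fun w => F w * (Cinv (w - v) * Cinv (w - v)))%C p q a b) z.
Proof.
have [Hab Hq HD] := HF.
have [M [M0 HM]] := seg_bounded F p q a b HF.
set i := / del; set j := / (del / 2).
have i0 : 0 < i by apply: Rinv_0_lt_compat.
have j0 : 0 < j by apply: Rinv_0_lt_compat; lra.
set two := (C1 + C1)%C.
exists (segint (fun w => F w * (two * (Cinv (w - z) * Cinv (w - z) * Cinv (w - z))))%C p q a b).
apply: (segint_param (fun w v => F w * (Cinv (w - v) * Cinv (w - v)))%C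
  (fun w v => F w * (two * (Cinv (w - v) * Cinv (w - v) * Cinv (w - v))))%C
  _ _ _ _ _ (del / 2) (M * (i * i * j * (j + i + i)))).
- lra.
- apply: Rmult_le_pos => //; left; apply: Rmult_lt_0_compat; last lra.
  by do 2 apply: Rmult_lt_0_compat => //.
- move=> u Hu; split=> // t Ht; apply: cdiff_mul; first exact: HD.
  by apply: cdiff_mul; exact: cdiff_inv.
- split=> // t Ht; apply: cdiff_mul; first exact: HD.
  by apply: cdiff_scal; apply: cdiff_mul; [apply: cdiff_mul|]; exact: cdiff_inv0.
move=> u t Hu Ht.
set s := seg p q t.
have n1 := nz u t Hu Ht; have n2 := nz0 t Ht.
have -> : (F s * (Cinv (s - (z + u)) * Cinv (s - (z + u))) - F s * (Cinv (s - z) * Cinv (s - z))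
   - F s * (two * (Cinv (s - z) * Cinv (s - z) * Cinv (s - z))) * u
  = F s * (Cinv (s - z) * Cinv (s - z) * Cinv (s - (z + u))
     * (Cinv (s - (z + u)) + Cinv (s - z) + Cinv (s - z))) * (u * u))%C.
  by rewrite /two; field; split.
rewrite !Cnorm_mul.
have T := Cnorm_triangle (Cinv (s - (z + u)) + Cinv (s - z))%C (Cinv (s - z))%C.
have T' := Cnorm_triangle (Cinv (s - (z + u)))%C (Cinv (s - z))%C.
have := HM t Ht; have := inv_le _ _ Hdel (Hsep t Ht).
have := inv_le _ (del / 2) ltac:(lra) (sep u t Hu Ht); rewrite -/s -/i -/j.
have := Cnorm_ge0 (F s); have := Cnorm_ge0 u.
have := Cnorm_ge0 (Cinv (s - (z + u)) + Cinv (s - z) + Cinv (s - z))%C.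
move: T T'.
set A := Cnorm (F s); set B := Cnorm (Cinv (s - z)%C); set D := Cnorm (Cinv _).
set E := Cnorm (_ + _)%C; set E' := Cnorm (_ + _)%C.
move=> T T' E0 U0 A0 HD' HB HA.
apply: Rmult_le_compat_r; first exact: Rmult_le_pos.
have BB : B * B <= i * i by apply: Rmult_le_compat; lra.
have B0 : 0 <= B * B by apply: Rmult_le_pos; lra.
have BD0 : 0 <= B * B * D by apply: Rmult_le_pos; lra.
have BBD : B * B * D <= i * i * j by apply: Rmult_le_compat; lra.
have BBDE : B * B * D * E <= i * i * j * (j + i + i) by apply: Rmult_le_compat; lra.
by apply: Rmult_le_compat => //; apply: Rmult_le_pos; lra.
Qed.
End CauchyKernel.

(** Near [z0] Cauchy's formula writes [h] as a multiple of [H], whose derivative is [H1] by the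
    first kernel lemma. Uniqueness of derivatives identifies [h'] with the same multiple of [H1],
    and [H1] is differentiable by the second kernel lemma. Nothing is assumed about the regularity
    of [h']. *)
Theorem cderiv_cdiff (h h' : C -> C) (z0 : C) (r : R) : 0 < r ->
  (forall u, Cnorm u < r -> has_cderiv h (z0 + u)%C (h' (z0 + u)%C)) ->
  cdiff h' z0.
Proof.
move=> Hr Hh.
(* The square of half side [s] lies within distance [2 * s < r] of [z0], and a pole moved by less
   than [s / 2] stays at distance at least [s / 2] from its frame. *)
set s := r / 4; have s0 : 0 < s by rewrite /s; lra.
set a := fst z0 - s; set b := fst z0 + s; set c := snd z0 - s; set d := snd z0 + s.
have Hab : a <= b by rewrite /a /b; lra.
have Hcd : c <= d by rewrite /c /d; lra.
have Hin x y : a <= x <= b -> c <= y <= d -> cdiff h (x, y).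
  move=> Hx Hy.
  have -> : (x, y) = (z0 + ((x, y) - z0))%C by apply C_ext => /=; ring.
  exists (h' (z0 + ((x, y) - z0))%C); apply: Hh.
  apply: Rle_lt_trans (Cnorm_le_sum _) _ => /=.
  have : Rabs (x + - fst z0) <= s by apply: Rabs_le; rewrite /a /b in Hx; lra.
  have : Rabs (y + - snd z0) <= s by apply: Rabs_le; rewrite /c /d in Hy; lra.
  by rewrite /s; lra.
have sep u (P : C -> Prop) : Cnorm u < s / 2 ->
    (forall x y, a <= x <= b -> c <= y <= d -> s / 2 <= Cnorm ((x, y) - (z0 + u))%C -> P (x, y)) ->
    on_frame P a b c d.
  move=> Hu HP.
  have [V1 V2] : - Cnorm u <= fst u <= Cnorm u.
    by have := fst_le_Cnorm u; rewrite /Rabs; case: Rcase_abs; lra.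
  have [V3 V4] : - Cnorm u <= snd u <= Cnorm u.
    by have := snd_le_Cnorm u; rewrite /Rabs; case: Rcase_abs; lra.
  have f1 (w : C) : s / 2 <= Rabs (fst w) -> s / 2 <= Cnorm w.
    by move=> H; apply: Rle_trans H (fst_le_Cnorm w).
  have f2 (w : C) : s / 2 <= Rabs (snd w) -> s / 2 <= Cnorm w.
    by move=> H; apply: Rle_trans H (snd_le_Cnorm w).
  split=> t Ht; split; apply: HP; try lra.
  - by apply: f2 => /=; rewrite Rabs_left /c; lra.
  - by apply: f2 => /=; rewrite Rabs_right /d; lra.
  - by apply: f1 => /=; rewrite Rabs_left /a; lra.
  - by apply: f1 => /=; rewrite Rabs_right /b; lra.
pose H v := rectint (fun w => h w * Cinv (w - v))%C a b c d.
pose H1 v := rectint (fun w => h w * (Cinv (w - v) * Cinv (w - v)))%C a b c d.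
have okh y : c <= y <= d -> seg_ok h (0, y) C1 a b.
  by move=> Hy; apply: seg_ok_h => // t Ht; exact: Hin.
have okv x : a <= x <= b -> seg_ok h (x, 0) Ci c d.
  by move=> Hx; apply: seg_ok_v => // t Ht; exact: Hin.
have sp u : Cnorm u < s / 2 -> on_frame (fun w => s / 2 <= Cnorm (w - (z0 + u))%C) a b c d.
  by move=> Hu; apply: (sep u).
have s20 : 0 < s / 2 by lra.
have dH u : Cnorm u < s / 2 -> has_cderiv H (z0 + u)%C (H1 (z0 + u)%C).
  move=> /sp [S1 S2].
  by rewrite /H /H1 /rectint; apply: has_cderiv_sub; [apply: has_cderiv_sub; [apply: has_cderiv_add|]|];
    apply: (Cauchy_kernel_deriv1 _ _ _ _ _ _ (s / 2) s20);
    first [by apply: okh; lra | by apply: okv; lra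
          | by move=> t /S1 []; rewrite seg_h | by move=> t /S2 []; rewrite seg_v].
have dH1 : cdiff H1 z0.
  have [S1 S2] := sp C0 ltac:(by rewrite Cnorm0).
  have E0 : (z0 + C0)%C = z0 by ring.
  rewrite E0 in S1 S2.
  have k F p q x y : seg_ok F p q x y -> (forall t, x <= t <= y -> s / 2 <= Cnorm (seg p q t - z0)%C) ->
     cdiff (fun v => segint (fun w => F w * (Cinv (w - v) * Cinv (w - v)))%C p q x y) z0.
    by move=> G1 G2; exact: (Cauchy_kernel_deriv2 _ _ _ _ _ _ (s / 2) s20).
  have [d1 D1] : cdiff _ z0 := k h (0, c) C1 a b (okh c ltac:(lra)) ltac:(by move=> t /S1 []; rewrite seg_h).
  have [d2 D2] : cdiff _ z0 := k h (b, 0) Ci c d (okv b ltac:(lra)) ltac:(by move=> t /S2 []; rewrite seg_v).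
  have [d3 D3] : cdiff _ z0 := k h (0, d) C1 a b (okh d ltac:(lra)) ltac:(by move=> t /S1 []; rewrite seg_h).
  have [d4 D4] : cdiff _ z0 := k h (a, 0) Ci c d (okv a ltac:(lra)) ltac:(by move=> t /S2 []; rewrite seg_v).
  exists (d1 + d2 - d3 - d4)%C; rewrite /H1 /rectint.
  by do 2 apply: has_cderiv_sub => //; apply: has_cderiv_add.
pose K := (RtoC (2 * PI) * Ci)%C.
have K0 : K <> C0 by move=> /(f_equal snd) /=; have := PI_RGT_0; lra.
have HE u : Cnorm u < s / 2 -> h (z0 + u)%C = (Cinv K * H (z0 + u))%C.
  move=> Hu.
  have V1 : - Cnorm u <= fst u <= Cnorm u.
    by have := fst_le_Cnorm u; rewrite /Rabs; case: Rcase_abs; lra.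
  have V2 : - Cnorm u <= snd u <= Cnorm u.
    by have := snd_le_Cnorm u; rewrite /Rabs; case: Rcase_abs; lra.
  have -> : H (z0 + u)%C = (h (z0 + u) * K)%C.
    rewrite /H (Ceta (z0 + u)%C); apply: Cauchy_formula => //=; rewrite /a /b /c /d; lra.
  by field.
have h'E u : Cnorm u < s / 2 -> (Cinv K * H1 (z0 + u))%C = h' (z0 + u)%C.
  move=> Hu; apply: (has_cderiv_unique h (z0 + u)%C); last by apply: Hh; rewrite /s in Hu; lra.
  apply: (has_cderiv_near (fun v => Cinv K * H v)%C _ _ _ (s / 2 - Cnorm u)); first lra.
    move=> v Hv; have -> : (z0 + u + v = z0 + (u + v))%C by ring.
    by rewrite HE //; have := Cnorm_triangle u v; lra.
  have := has_cderiv_mul _ _ _ _ _ (has_cderiv_const (Cinv K) (z0 + u)%C) (dH u Hu).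
  by have -> : (C0 * H (z0 + u) + Cinv K * H1 (z0 + u) = Cinv K * H1 (z0 + u))%C by ring.
have [D HD] := cdiff_scal H1 (Cinv K) z0 dH1.
by exists D; apply: (has_cderiv_near _ _ _ _ _ s20 h'E HD).
Qed.

(** * Finite sums, vectors and matrices *)

Lemma CaddA : associative Cadd. Proof. by move=> x y z; ring. Qed.
Lemma CaddC : commutative Cadd. Proof. by move=> x y; ring. Qed.
Lemma Cadd0 : left_id C0 Cadd. Proof. by move=> x; ring. Qed.
Lemma CmulA : associative Cmul. Proof. by move=> x y z; ring. Qed.
Lemma CmulC : commutative Cmul. Proof. by move=> x y; ring. Qed.
Lemma Cmul1 : left_id C1 Cmul. Proof. by move=> x; ring. Qed.
Lemma Cmul0l : left_zero C0 Cmul. Proof. by move=> x; ring. Qed.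
Lemma Cmul0r : right_zero C0 Cmul. Proof. by move=> x; ring. Qed.
Lemma CmulDl : left_distributive Cmul Cadd. Proof. by move=> x y z; ring. Qed.
Lemma CmulDr : right_distributive Cmul Cadd. Proof. by move=> x y z; ring. Qed.
HB.instance Definition _ := Monoid.isComLaw.Build C C0 Cadd CaddA CaddC Cadd0.
HB.instance Definition _ := Monoid.isComLaw.Build C C1 Cmul CmulA CmulC Cmul1.
HB.instance Definition _ := Monoid.isMulLaw.Build C C0 Cmul Cmul0l Cmul0r.
HB.instance Definition _ := Monoid.isAddLaw.Build C Cmul Cadd CmulDl CmulDr.

Lemma RaddA : associative Rplus. Proof. by move=> x y z; ring. Qed.
Lemma RaddC : commutative Rplus. Proof. by move=> x y; ring. Qed.
Lemma Radd0 : left_id 0 Rplus. Proof. by move=> x; ring. Qed.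
HB.instance Definition _ := Monoid.isComLaw.Build R 0 Rplus RaddA RaddC Radd0.

Lemma Csum_ext m (F G : 'I_m -> C) : (forall i, F i = G i) -> Csum F = Csum G.
Proof. by move=> H; rewrite /Csum; apply: eq_bigr => i _; exact: H. Qed.

Lemma Csum_add m (F G : 'I_m -> C) :
  Csum (fun i => F i + G i)%C = (Csum F + Csum G)%C.
Proof. exact: big_split. Qed.

Lemma Csum_mull m k (F : 'I_m -> C) : Csum (fun i => k * F i)%C = (k * Csum F)%C.
Proof. by rewrite /Csum big_distrr. Qed.

Lemma Csum_mulr m k (F : 'I_m -> C) : Csum (fun i => F i * k)%C = (Csum F * k)%C.
Proof. by rewrite /Csum big_distrl. Qed.

Lemma Csum_opp m (F : 'I_m -> C) : Csum (fun i => - F i)%C = (- Csum F)%C.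
Proof.
rewrite (Csum_ext _ _ (fun i => (- C1) * F i)%C) ?Csum_mull; first ring.
by move=> i; ring.
Qed.

Lemma Csum_sub m (F G : 'I_m -> C) :
  Csum (fun i => F i - G i)%C = (Csum F - Csum G)%C.
Proof. by rewrite Csum_add Csum_opp. Qed.

Lemma Csum0 m : Csum (fun _ : 'I_m => C0) = C0.
Proof. by rewrite /Csum big1. Qed.

Lemma Csum_exchange m k (F : 'I_m -> 'I_k -> C) :
  Csum (fun i => Csum (fun j => F i j)) = Csum (fun j => Csum (fun i => F i j)).
Proof. exact: exchange_big. Qed.

Lemma Csum_pick m (j : 'I_m) (F : 'I_m -> C) :
  (forall i, i != j -> F i = C0) -> Csum F = F j.
Proof. by move=> H; rewrite /Csum (bigD1 j) //= big1 ?Monoid.mulm1. Qed.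

Lemma Rsum_le m (F G : 'I_m -> R) : (forall i, F i <= G i) -> Rsum F <= Rsum G.
Proof.
by move=> H; rewrite /Rsum; elim/big_ind2: _ => // [|x1 x2 y1 y2]; lra.
Qed.

Lemma Rsum_ge0 m (F : 'I_m -> R) : (forall i, 0 <= F i) -> 0 <= Rsum F.
Proof. by move=> H; rewrite /Rsum; elim/big_ind: _ => // [|x y]; lra. Qed.

Lemma Rsum_add m (F G : 'I_m -> R) : Rsum (fun i => F i + G i) = Rsum F + Rsum G.
Proof. exact: big_split. Qed.

Lemma Rsum_mull m k (F : 'I_m -> R) : Rsum (fun i => k * F i) = k * Rsum F.
Proof. by rewrite /Rsum; elim/big_ind2: _ => // [|x1 x2 y1 y2 -> ->]; ring. Qed.

Lemma Rsum_exchange m k (F : 'I_m -> 'I_k -> R) :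
  Rsum (fun i => Rsum (fun j => F i j)) = Rsum (fun j => Rsum (fun i => F i j)).
Proof. exact: exchange_big. Qed.

Lemma Rsum_ext m (F G : 'I_m -> R) : (forall i, F i = G i) -> Rsum F = Rsum G.
Proof. by move=> H; rewrite /Rsum; apply: eq_bigr => i _; exact: H. Qed.

Lemma Rsum_ge_term m (F : 'I_m -> R) j : (forall i, 0 <= F i) -> F j <= Rsum F.
Proof.
move=> H; rewrite /Rsum (bigD1 j) //=.
rewrite -[X in X <= _]Rplus_0_r; apply: Rplus_le_compat_l.
by elim/big_ind: _ => [|x y|i _]; [lra|lra|exact: H].
Qed.

Lemma Cnorm_Csum m (F : 'I_m -> C) : Cnorm (Csum F) <= Rsum (fun i => Cnorm (F i)).
Proof.
rewrite /Csum /Rsum; elim/big_ind2: _ => [|x1 x2 y1 y2 H1 H2|i _]; try lra.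
- by rewrite Cnorm0; lra.
- by apply: Rle_trans (Cnorm_triangle _ _) _; lra.
Qed.

Section MatrixAlgebra.
Context {n : nat}.
Implicit Types (A B D : mat n) (u v : vec n).

Lemma vec_ext u v : (forall a, u a = v a) -> u = v.
Proof. exact: functional_extensionality. Qed.

Lemma mat_ext A B : (forall a b, A a b = B a b) -> A = B.
Proof. by move=> H; do 2 apply: functional_extensionality => ?; exact: H. Qed.

Lemma mmulA A B D : mmul A (mmul B D) = mmul (mmul A B) D.
Proof.
apply: mat_ext => a b; rewrite /mmul.
rewrite (Csum_ext _ _ (fun c => Csum (fun d => A a c * (B c d * D d b))%C)); last first.
  by move=> c; rewrite Csum_mull.
rewrite Csum_exchange; apply: Csum_ext => c; rewrite -Csum_mulr.
by apply: Csum_ext => d; ring.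
Qed.

Lemma mvmul_mmul A B v : mvmul (mmul A B) v = mvmul A (mvmul B v).
Proof.
apply: vec_ext => a; rewrite /mmul /mvmul.
rewrite [RHS](Csum_ext _ _ (fun c => Csum (fun d => A a c * (B c d * v d))%C)); last first.
  by move=> c; rewrite Csum_mull.
rewrite Csum_exchange; apply: Csum_ext => c; rewrite -Csum_mulr.
by apply: Csum_ext => d; ring.
Qed.

Lemma mmul1 A : mmul (@mid n) A = A.
Proof.
apply: mat_ext => a b; rewrite /mmul (Csum_pick _ a) /mid ?eqxx; first by ring.
by move=> i; rewrite eq_sym => /negbTE ->; ring.
Qed.

Lemma mmulm1 A : mmul A (@mid n) = A.
Proof.
apply: mat_ext => a b; rewrite /mmul (Csum_pick _ b) /mid ?eqxx; first by ring.
by move=> i /negbTE ->; ring.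
Qed.

Lemma mvmul1 v : mvmul (@mid n) v = v.
Proof.
apply: vec_ext => a; rewrite /mvmul (Csum_pick _ a) /mid ?eqxx; first by ring.
by move=> i; rewrite eq_sym => /negbTE ->; ring.
Qed.

Lemma mvmul_add A u v : mvmul A (vadd u v) = vadd (mvmul A u) (mvmul A v).
Proof.
by apply: vec_ext => a; rewrite /mvmul /vadd -Csum_add; apply: Csum_ext => c; ring.
Qed.

Lemma mvmul_sub A u v : mvmul A (vsub u v) = vsub (mvmul A u) (mvmul A v).
Proof.
by apply: vec_ext => a; rewrite /mvmul /vsub -Csum_sub; apply: Csum_ext => c; ring.
Qed.

Lemma mvmul_scale A k v : mvmul A (vscale k v) = vscale k (mvmul A v).
Proof.
by apply: vec_ext => a; rewrite /mvmul /vscale -Csum_mull; apply: Csum_ext => c; ring.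
Qed.

Lemma mvmul0 A : mvmul A (@vzero n) = @vzero n.
Proof.
apply: vec_ext => a; rewrite /mvmul /vzero -[RHS](Csum0 n).
by apply: Csum_ext => c; ring.
Qed.

Lemma mvmul_vsum A m (F : 'I_m -> vec n) :
  mvmul A (vsum F) = vsum (fun j => mvmul A (F j)).
Proof.
apply: vec_ext => a; rewrite /mvmul /vsum Csum_exchange.
by apply: Csum_ext => c; rewrite Csum_mull.
Qed.

Lemma mvmul_msub A B v : mvmul (msub A B) v = vsub (mvmul A v) (mvmul B v).
Proof.
by apply: vec_ext => a; rewrite /mvmul /vsub -Csum_sub; apply: Csum_ext => c; rewrite /msub; ring.
Qed.

Lemma mvmul_mscale k A v : mvmul (mscale k A) v = vscale k (mvmul A v).
Proof.
by apply: vec_ext => a; rewrite /mvmul /vscale -Csum_mull; apply: Csum_ext => c; rewrite /mscale; ring.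
Qed.

Lemma mvmul_msum m (F : 'I_m -> mat n) v :
  mvmul (msum F) v = vsum (fun j => mvmul (F j) v).
Proof.
apply: vec_ext => a; rewrite /mvmul /vsum Csum_exchange.
by apply: Csum_ext => c; rewrite -Csum_mulr.
Qed.

Lemma mmul_addl A B D : mmul (madd A B) D = madd (mmul A D) (mmul B D).
Proof.
by apply: mat_ext => a b; rewrite /mmul /madd -Csum_add; apply: Csum_ext => c; ring.
Qed.

Lemma mmul_addr A B D : mmul A (madd B D) = madd (mmul A B) (mmul A D).
Proof.
by apply: mat_ext => a b; rewrite /mmul /madd -Csum_add; apply: Csum_ext => c; ring.
Qed.

Lemma mmul_scalel k A B : mmul (mscale k A) B = mscale k (mmul A B).
Proof.
by apply: mat_ext => a b; rewrite /mmul /mscale -Csum_mull; apply: Csum_ext => c; ring.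
Qed.

Lemma mmul_scaler k A B : mmul A (mscale k B) = mscale k (mmul A B).
Proof.
by apply: mat_ext => a b; rewrite /mmul /mscale -Csum_mull; apply: Csum_ext => c; ring.
Qed.

Lemma minvP A : minvertible A -> mmul A (minv A) = @mid n /\ mmul (minv A) A = @mid n.
Proof. by move=> H; exact: (epsilon_spec (inhabits (@mid n)) _ H). Qed.

Lemma minv_unique A B : mmul A B = @mid n -> mmul B A = @mid n -> minv A = B.
Proof.
move=> H1 H2; have [H3 _] : mmul A (minv A) = @mid n /\ mmul (minv A) A = @mid n.
  by apply: minvP; exists B.
by rewrite -[LHS]mmul1 -H2 -mmulA H3 mmulm1.
Qed.

(** * Entrywise matrix norm and differentiability of the inverse *)

(** The entrywise l1 norm. It is subadditive and submultiplicative and dominates each entry, which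
    is all that the inverse requires. *)
Definition mnorm A : R := Rsum (fun a => Rsum (fun b => Cnorm (A a b))).

Lemma mnorm_ge0 A : 0 <= mnorm A.
Proof. by do 2 apply: Rsum_ge0 => ?; exact: Cnorm_ge0. Qed.

Lemma mnorm_ge_entry A a b : Cnorm (A a b) <= mnorm A.
Proof.
apply: (Rle_trans _ (Rsum (fun b => Cnorm (A a b)))).
  by apply: (Rsum_ge_term _ (fun b => Cnorm (A a b))) => ?; exact: Cnorm_ge0.
apply: (Rsum_ge_term _ (fun a => Rsum (fun b => Cnorm (A a b)))) => c.
by apply: Rsum_ge0 => ?; exact: Cnorm_ge0.
Qed.

Lemma mnorm_add A B : mnorm (madd A B) <= mnorm A + mnorm B.
Proof.
rewrite /mnorm -Rsum_add; apply: Rsum_le => a; rewrite -Rsum_add; apply: Rsum_le => b.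
exact: Cnorm_triangle.
Qed.

Lemma mnorm_scale k A : mnorm (mscale k A) = Cnorm k * mnorm A.
Proof.
rewrite /mnorm -Rsum_mull; apply: Rsum_ext => a; rewrite -Rsum_mull; apply: Rsum_ext => b.
exact: Cnorm_mul.
Qed.

Lemma mnorm_mul A B : mnorm (mmul A B) <= mnorm A * mnorm B.
Proof.
rewrite Rmult_comm {1 2}/mnorm -Rsum_mull; apply: Rsum_le => a.
apply: (Rle_trans _ (Rsum (fun b => Rsum (fun c => Cnorm (A a c) * Cnorm (B c b))))).
  apply: Rsum_le => b; apply: Rle_trans (Cnorm_Csum _ _) _.
  by apply: Rsum_le => c; rewrite Cnorm_mul; lra.
rewrite Rsum_exchange -Rsum_mull; apply: Rsum_le => c; rewrite Rsum_mull Rmult_comm.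
apply: Rmult_le_compat_r; first exact: Cnorm_ge0.
apply: (Rsum_ge_term _ (fun c => Rsum (fun b => Cnorm (B c b)))) => d.
by apply: Rsum_ge0 => ?; exact: Cnorm_ge0.
Qed.

Lemma mnorm_deriv (A : C -> mat n) (A' : mat n) z :
  (forall a b, has_cderiv (fun u : C => A u a b) z (A' a b)) ->
  forall eps, 0 < eps -> exists del, 0 < del /\ forall u : C, Cnorm u < del ->
    mnorm (madd (madd (A (z + u)%C) (mscale (- C1)%C (A z))) (mscale (- u)%C A')) <= eps * Cnorm u.
Proof.
move=> H eps He.
(* Finitely many radii have a positive minimum. [P] depends on the modulus of the increment only, so
   the minimum can be taken twice, over columns and then over rows. *)
have uni m (P : 'I_m -> R -> Prop) :
    (forall i, exists del, 0 < del /\ forall r, r < del -> P i r) ->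
    exists del, 0 < del /\ forall r, r < del -> forall i, P i r.
  move=> HP.
  pose f i := proj1_sig (constructive_indefinite_description _ (HP i)).
  have fP i := proj2_sig (constructive_indefinite_description _ (HP i)).
  exists (\big[Rmin/1]_(i < m) f i); split.
    elim/big_ind: _ => [|x y|i _]; [lra|exact: Rmin_glb_lt|exact: (proj1 (fP i))].
  move=> r Hr i; apply: (proj2 (fP i)); apply: Rlt_le_trans Hr _.
  rewrite -/(f i); have := mem_index_enum i.
  elim: (index_enum _) => [//|j s IH]; rewrite in_cons big_cons => /orP [/eqP <-|/IH K].
    exact: Rmin_l.
  exact: Rle_trans (Rmin_r _ _) K.
have Hn0 : 0 <= INR n by exact: pos_INR.
have Hn : 0 < INR n * INR n + 1 by nra.
(* There are [n * n] entries, each with error at most [e * Cnorm u]; the added 1 covers [n = 0]. *)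
set e := eps / (INR n * INR n + 1).
have e0 : 0 < e by apply: Rdiv_lt_0_compat.
pose P a b r := forall u : C, Cnorm u = r -> Cnorm (A (z + u) a b - A z a b - A' a b * u)%C <= e * Cnorm u.
have [|del [H0 Hd]] := uni n (fun a r => forall b, P a b r).
  move=> a; apply: uni => b; have [d [d0 Hd]] := H a b e e0.
  by exists d; split=> // r Hr u Hu; apply: Hd; rewrite Hu.
exists del; split=> // u Hu.
have sumc m c : Rsum (fun _ : 'I_m => c) = INR m * c.
  rewrite /Rsum big_const_ord; elim: m => [|m IH]; first by rewrite /=; ring.
  by rewrite iterS IH S_INR; ring.
apply: (Rle_trans _ (Rsum (fun a => Rsum (fun b => e * Cnorm u)))).
  apply: Rsum_le => a; apply: Rsum_le => b; apply: Rle_trans (Hd _ Hu a b u erefl).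
  by right; congr Cnorm; rewrite /madd /mscale; ring.
rewrite !sumc; have u0 := Cnorm_ge0 u.
have E : e * (INR n * INR n + 1) = eps by rewrite /e; field; lra.
have : 0 <= e * Cnorm u by apply: Rmult_le_pos; lra.
rewrite -E; lra.
Qed.

(** The derivative is [- X0 A' X0]. The resolvent identity [X = X0 - X E X0], with [E] the increment
    of [A], first bounds [X] and then, inserted into itself, isolates a second-order error. *)
Lemma cdiff_minv (A : C -> mat n) (z : C) (r : R) : 0 < r ->
  (forall u : C, Cnorm u < r -> minvertible (A (z + u)%C)) ->
  (forall a b, cdiff (fun u : C => A u a b) z) ->
  forall a b, cdiff (fun u : C => minv (A u) a b) z.
Proof.
move=> Hr Hinv HA a b.
pose A' : mat n := fun a b => proj1_sig (constructive_indefinite_description _ (HA a b)).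
have HA' a' b' : has_cderiv (fun u : C => A u a' b') z (A' a' b') :=
  proj2_sig (constructive_indefinite_description _ (HA a' b')).
have Hd := mnorm_deriv A A' z HA'.
set X0 := minv (A z).
have [I1 I2] : mmul (A z) X0 = @mid n /\ mmul X0 (A z) = @mid n.
  apply: minvP; have := Hinv C0; rewrite Cnorm0; have -> : (z + C0)%C = z by ring.
  exact.
exists (- mmul (mmul X0 A') X0 a b)%C => eps He.
set x := mnorm X0; have x0 : 0 <= x by exact: mnorm_ge0.
set k := mnorm A' + 1; have k0 : 0 < k by have := mnorm_ge0 A'; rewrite /k; lra.
have [d1 [D1 H1]] := Hd 1 Rlt_0_1.
have q1 : 0 < x * x + 1 by nra.
have [d2 [D2 H2]] := Hd (eps / (2 * (x * x + 1))) ltac:(apply: Rdiv_lt_0_compat; lra).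
have q2 : 0 < 2 * k * (x + 1) by do ?apply: Rmult_lt_0_compat; lra.
have q3 : 0 < 4 * (x * x * x * k * k + 1).
  have : 0 <= x * x * x * k * k by do ?apply: Rmult_le_pos; lra.
  lra.
have q2' : 0 < / (2 * k * (x + 1)) by apply: Rinv_0_lt_compat.
have q3' : 0 < eps / (4 * (x * x * x * k * k + 1)) by apply: Rdiv_lt_0_compat.
exists (Rmin (Rmin r (Rmin d1 d2)) (Rmin (/ (2 * k * (x + 1))) (eps / (4 * (x * x * x * k * k + 1))))).
split; first by do ?apply: Rmin_glb_lt.
move=> u Hu.
have [u1 [u2 [u3 [u4 u5]]]] : Cnorm u < r /\ Cnorm u < d1 /\ Cnorm u < d2 /\
  Cnorm u < / (2 * k * (x + 1)) /\ Cnorm u < eps / (4 * (x * x * x * k * k + 1)).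
  move: Hu; set m1 := Rmin r _; set m2 := Rmin (/ _) _.
  have := Rmin_l m1 m2; have := Rmin_r m1 m2.
  have : m1 <= r by exact: Rmin_l.
  have : m1 <= d1 by apply: Rle_trans (Rmin_r _ _) (Rmin_l _ _).
  have : m1 <= d2 by apply: Rle_trans (Rmin_r _ _) (Rmin_r _ _).
  have : m2 <= / (2 * k * (x + 1)) by exact: Rmin_l.
  have : m2 <= eps / (4 * (x * x * x * k * k + 1)) by exact: Rmin_r.
  by move=> *; do ?split; lra.
have u0 := Cnorm_ge0 u.
set X := minv (A (z + u)%C).
have [J1 J2] := minvP _ (Hinv u u1); rewrite -/X in J1 J2.
set E := madd (A (z + u)%C) (mscale (- C1)%C (A z)).
set rr := madd E (mscale (- u)%C A').
have Er : E = madd rr (mscale u A').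
  by apply: mat_ext => i j; rewrite /rr /madd /mscale; ring.
have XE : X = madd X0 (mscale (- C1)%C (mmul (mmul X E) X0)).
  rewrite /E mmul_addr J2 mmul_scaler mmul_addl mmul1 mmul_scalel -mmulA I1 mmulm1.
  by apply: mat_ext => i j; rewrite /madd /mscale; ring.
have nE : mnorm E <= k * Cnorm u.
  rewrite Er; apply: Rle_trans (mnorm_add _ _) _; rewrite mnorm_scale /k.
  have := H1 u u2; rewrite -/E -/rr; lra.
have nE0 := mnorm_ge0 E.
(* The identity gives [mnorm X <= x + mnorm X * mnorm E * x]; since [mnorm E * x <= 1/2], the last
   term is absorbed on the left. *)
have nX : mnorm X <= 2 * x.
  have T : mnorm X <= x + mnorm X * mnorm E * x.
    rewrite {1}XE; apply: Rle_trans (mnorm_add _ _) _.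
    rewrite mnorm_scale Cnorm_opp Cnorm1 Rmult_1_l; apply: Rplus_le_compat_l.
    apply: Rle_trans (mnorm_mul _ _) _; apply: Rmult_le_compat_r => //; exact: mnorm_mul.
  have Ex : mnorm E * x <= / 2.
    apply: (Rle_trans _ (k * / (2 * k * (x + 1)) * (x + 1))); last by right; field; lra.
    apply: Rmult_le_compat => //; last lra.
    by apply: Rle_trans nE _; apply: Rmult_le_compat_l; lra.
  have : mnorm X * (mnorm E * x) <= mnorm X * / 2.
    by apply: Rmult_le_compat_l => //; exact: mnorm_ge0.
  lra.
(* One more use of [XE] inside itself: the linear part of [E] cancels against the derivative,
   leaving the remainder [rr] and a term quadratic in [E]. *)
have key : madd (madd X (mscale (- C1)%C X0)) (mscale u (mmul (mmul X0 A') X0)) =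
    madd (mscale (- C1)%C (mmul (mmul X0 rr) X0)) (mmul (mmul (mmul (mmul X E) X0) E) X0).
  have -> : madd X (mscale (- C1)%C X0) = mscale (- C1)%C (mmul (mmul X E) X0).
    by rewrite {1}XE; apply: mat_ext => i j; rewrite /madd /mscale; ring.
  rewrite {1}XE !mmul_addl !mmul_scalel.
  rewrite {1}Er !mmul_addr !mmul_addl !mmul_scaler !mmul_scalel.
  by apply: mat_ext => i j; rewrite /madd /mscale; ring.
have -> : (minv (A (z + u)) a b - minv (A z) a b - (- mmul (mmul X0 A') X0 a b) * u)%C =
    madd (madd X (mscale (- C1)%C X0)) (mscale u (mmul (mmul X0 A') X0)) a b.
  by rewrite /madd /mscale -/X -/X0; ring.
rewrite key; apply: Rle_trans (mnorm_ge_entry _ a b) _.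
apply: Rle_trans (mnorm_add _ _) _; rewrite mnorm_scale Cnorm_opp Cnorm1 Rmult_1_l.
have B1 : mnorm (mmul (mmul X0 rr) X0) <= eps / 2 * Cnorm u.
  apply: Rle_trans (mnorm_mul _ _) _.
  apply: (Rle_trans _ (x * mnorm rr * x)).
    by apply: Rmult_le_compat_r => //; exact: mnorm_mul.
  have {}H2 := H2 u u3; rewrite -/E -/rr in H2.
  have -> : x * mnorm rr * x = x * x * mnorm rr by ring.
  apply: (Rle_trans _ (x * x * (eps / (2 * (x * x + 1)) * Cnorm u))).
    by apply: Rmult_le_compat_l => //; nra.
  have -> : x * x * (eps / (2 * (x * x + 1)) * Cnorm u) =
     eps / 2 * Cnorm u - eps / (2 * (x * x + 1)) * Cnorm u by field; lra.
  have : 0 <= eps / (2 * (x * x + 1)) * Cnorm u.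
    by apply: Rmult_le_pos => //; left; apply: Rdiv_lt_0_compat; lra.
  lra.
have B2 : mnorm (mmul (mmul (mmul (mmul X E) X0) E) X0) <= eps / 2 * Cnorm u.
  apply: (Rle_trans _ ((2 * x) * (k * Cnorm u) * x * (k * Cnorm u) * x)).
    apply: Rle_trans (mnorm_mul _ _) _; apply: Rmult_le_compat_r => //.
    apply: Rle_trans (mnorm_mul _ _) _; apply: Rmult_le_compat => //; try exact: mnorm_ge0.
    apply: Rle_trans (mnorm_mul _ _) _; apply: Rmult_le_compat_r => //.
    by apply: Rle_trans (mnorm_mul _ _) _; apply: Rmult_le_compat => //; exact: mnorm_ge0.
  have -> : (2 * x) * (k * Cnorm u) * x * (k * Cnorm u) * x =
    (2 * (x * x * x * k * k) * Cnorm u) * Cnorm u by ring.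
  apply: Rmult_le_compat_r => //.
  have q4 : 0 <= x * x * x * k * k by do ?apply: Rmult_le_pos; lra.
  apply: (Rle_trans _ (2 * (x * x * x * k * k + 1) * (eps / (4 * (x * x * x * k * k + 1))))).
    by apply: Rmult_le_compat; lra.
  by right; field; lra.
lra.
Qed.
End MatrixAlgebra.

(** * Partial derivatives *)

Definition has_pd {N} (g : pt N -> C) (i : 'I_N) (x : pt N) (d : C) : Prop :=
  has_cderiv (fun u => g (pupd x i u)) C0 d.

Definition pdiff {N} (g : pt N -> C) (i : 'I_N) (x : pt N) : Prop :=
  exists d, has_pd g i x d.

Section PartialDerivatives.
Context {N : nat}.
Implicit Types (g h : pt N -> C) (i j : 'I_N) (x y : pt N).

Lemma pt_ext x y : (forall k, x k = y k) -> x = y.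
Proof. exact: functional_extensionality. Qed.

Lemma pupd0 x i : pupd x i C0 = x.
Proof. by apply: pt_ext => k; rewrite /pupd; case: eqP => // _; ring. Qed.

Lemma pupd_add x i u v : pupd (pupd x i u) i v = pupd x i (u + v)%C.
Proof. by apply: pt_ext => k; rewrite /pupd; case: eqP => // _; ring. Qed.

Lemma near_pupd x i u d : Cnorm u < d -> near_pt x (pupd x i u) d.
Proof.
move=> H k; rewrite /pupd; case: eqP => _.
  by have -> : (x k + u - x k = u)%C by ring.
have -> : (x k - x k = C0)%C by ring.
by rewrite Cnorm0; have := Cnorm_ge0 u; lra.
Qed.

(** This is why a derivative in direction [i] of a reflected function becomes a derivative in
    direction [j]. *)
Lemma pact_pupd x i u (w : {perm 'I_N}) : pact (pupd x (w i) u) w = pupd (pact x w) i u.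
Proof.
by apply: pt_ext => k; rewrite /pact /pupd (inj_eq perm_inj).
Qed.

Lemma has_pdE g i x d : has_pderiv g i x d <-> has_pd g i x d.
Proof.
split=> H eps He.
  have [del [D0 Hd]] := H eps He; exists del; split=> // u Hu.
  have E : (C0 + u = u)%C by ring.
  rewrite E pupd0.
  have [U|U] := Req_dec (Cnorm u) 0.
    rewrite (Cnorm_eq0 u U) pupd0 Cnorm0.
    have -> : (g x - g x - d * C0 = C0)%C by ring.
    by rewrite Cnorm0; lra.
  have u0 := Cnorm_ge0 u.
  have {}Hd := Hd u ltac:(lra).
  have un : u <> C0 by apply: Cnorm_neq0; lra.
  have -> : (g (pupd x i u) - g x - d * u = ((g (pupd x i u) - g x) / u - d) * u)%C by field.
  by rewrite Cnorm_mul; apply: Rmult_le_compat_r; lra.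
(* Halving [eps] recovers the strict inequality of the quotient form from the weak one. *)
have [del [D0 Hd]] := H (eps / 2) ltac:(lra); exists del; split=> // u [Hu0 Hu].
have {}Hd := Hd u Hu.
have E : (C0 + u = u)%C by ring.
rewrite E pupd0 in Hd.
have un := Cnorm_neq0 u Hu0.
apply: (Rmult_lt_reg_r (Cnorm u)) => //; rewrite -Cnorm_mul.
have <- : (g (pupd x i u) - g x - d * u = ((g (pupd x i u) - g x) / u - d) * u)%C by field.
by have := Rmult_lt_0_compat _ _ He Hu0; lra.
Qed.

(** Uniqueness of derivatives identifies the value picked by [epsilon]; without existence that value
    says nothing. *)
Lemma pderivE g i x d : has_pd g i x d -> pderiv g i x = d.
Proof.
move=> H; apply: (has_cderiv_unique _ _ _ _ _ H); apply/has_pdE.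
by apply: (epsilon_spec (inhabits C0) (fun d => has_pderiv g i x d)); exists d; apply/has_pdE.
Qed.

Lemma pdiffP g i x : pdiff g i x -> has_pd g i x (pderiv g i x).
Proof. by move=> [d H]; rewrite (pderivE _ _ _ _ H). Qed.

Lemma has_pd_shift g i x u d : has_pd g i (pupd x i u) d ->
  has_cderiv (fun v => g (pupd x i v)) u d.
Proof.
move=> H eps He; have [del [D0 Hd]] := H eps He; exists del; split=> // v Hv.
by have := Hd v Hv; rewrite !pupd_add; have -> : (u + (C0 + v) = u + v)%C by [ring];
  have -> : (u + C0 = u)%C by ring.
Qed.

Lemma has_pd_const k i x : has_pd (fun _ => k) i x C0.
Proof. exact: has_cderiv_const. Qed.

Lemma has_pd_sub g h i x a b : has_pd g i x a -> has_pd h i x b ->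
  has_pd (fun y => g y - h y)%C i x (a - b)%C.
Proof. exact: has_cderiv_sub. Qed.

Lemma has_pd_mul g h i x a b : has_pd g i x a -> has_pd h i x b ->
  has_pd (fun y => g y * h y)%C i x (a * h x + g x * b)%C.
Proof. by move=> Hg Hh; have := has_cderiv_mul _ _ _ _ _ Hg Hh; rewrite pupd0. Qed.

Lemma has_pd_scal k h i x b : has_pd h i x b -> has_pd (fun y => k * h y)%C i x (k * b)%C.
Proof.
move=> Hh; have := has_pd_mul _ _ _ _ _ _ (has_pd_const k i x) Hh.
by have -> : (C0 * h x + k * b = k * b)%C by ring.
Qed.

Lemma has_pd_coord i x k : has_pd (fun y => y k) i x (if k == i then C1 else C0).
Proof.
rewrite /has_pd /pupd; case: eqP => _; last exact: has_cderiv_const.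
have := has_cderiv_add _ _ _ _ _ (has_cderiv_const (x k) C0) (has_cderiv_id C0).
by have -> : (C0 + C1 = C1)%C by ring.
Qed.

(** Chain rule by hand: the estimate for [Cinv] at [g x] is applied to the increment [G - g x],
    which continuity makes small and differentiability makes linear in [u]. *)
Lemma has_pd_inv g i x a : g x <> C0 -> has_pd g i x a ->
  has_pd (fun y => Cinv (g y)) i x (- (a * (Cinv (g x) * Cinv (g x))))%C.
Proof.
move=> Hx Hg eps He.
have Hi := has_cderiv_inv _ Hx.
set B := (Cinv (g x) * Cinv (g x))%C in Hi *.
have A0 := Cnorm_ge0 a; have B0 := Cnorm_ge0 B.
set k := 1 + Cnorm a + Cnorm B.
have k0 : 0 < k by rewrite /k; lra.
have e0 : 0 < eps / (2 * k) by apply: Rdiv_lt_0_compat; lra.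
have [d1 [D1 H1]] := Hi _ e0.
have [d2 [D2 H2]] := Hg 1 Rlt_0_1.
have [d3 [D3 H3]] := Hg _ e0.
have [d4 [D4 H4]] := has_cderiv_continuous _ _ _ Hg d1 D1.
exists (Rmin (Rmin d2 d3) d4); split; first by do 2 apply: Rmin_glb_lt => //.
move=> u Hu.
have m1 := Rmin_l (Rmin d2 d3) d4; have m2 := Rmin_r (Rmin d2 d3) d4.
have m3 := Rmin_l d2 d3; have m4 := Rmin_r d2 d3.
have {}H2 := H2 u ltac:(lra); have {}H3 := H3 u ltac:(lra); have {}H4 := H4 u ltac:(lra).
rewrite pupd0 in H2 H3 H4 *.
set G := g (pupd x i (C0 + u)%C) in H2 H3 H4 *.
have := H1 (G - g x)%C H4; have -> : (g x + (G - g x) = G)%C by ring.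
move=> {}H1.
have -> : (Cinv G - Cinv (g x) - - (a * B) * u =
  (Cinv G - Cinv (g x) - (- B) * (G - g x)) - B * (G - g x - a * u))%C by ring.
apply: Rle_trans (Cnorm_sub _ _) _; rewrite Cnorm_mul.
have T : Cnorm (G - g x)%C <= (1 + Cnorm a) * Cnorm u.
  have -> : (G - g x = (G - g x - a * u) + a * u)%C by ring.
  by apply: Rle_trans (Cnorm_triangle _ _) _; rewrite Cnorm_mul; lra.
have u0 := Cnorm_ge0 u.
have T1 : eps / (2 * k) * Cnorm (G - g x)%C <= eps / (2 * k) * ((1 + Cnorm a) * Cnorm u).
  by apply: Rmult_le_compat_l => //; lra.
have T2 : Cnorm B * Cnorm (G - g x - a * u)%C <= Cnorm B * (eps / (2 * k) * Cnorm u).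
  exact: Rmult_le_compat_l.
have E : eps / (2 * k) * k = eps / 2 by field; lra.
have : eps / (2 * k) * k * Cnorm u = eps / 2 * Cnorm u by rewrite E.
have : 0 <= eps * Cnorm u by apply: Rmult_le_pos; lra.
rewrite {2}/k; lra.
Qed.

Lemma has_pd_Csum m (F : 'I_m -> pt N -> C) (d : 'I_m -> C) i x :
  (forall k, has_pd (F k) i x (d k)) -> has_pd (fun y => Csum (fun k => F k y)) i x (Csum d).
Proof.
move=> H; rewrite /has_pd /Csum; elim: (index_enum _) => [|k s IH].
  rewrite big_nil; apply: (has_cderiv_near _ _ _ _ 1 Rlt_0_1 _ (has_cderiv_const C0 C0)).
  by move=> u _; rewrite big_nil.
rewrite big_cons; apply: (has_cderiv_near _ _ _ _ 1 Rlt_0_1 _ (has_cderiv_add _ _ _ _ _ (H k) IH)).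
by move=> u _; rewrite big_cons.
Qed.

Section OnOpenSet.
Variables (Om : pt N -> Prop) (HOm : open_pts Om).

Lemma open_pupd x i : Om x -> exists r, 0 < r /\ forall u, Cnorm u < r -> Om (pupd x i u).
Proof.
move=> /HOm [d [d0 Hd]]; exists d; split=> // u Hu; apply: Hd; exact: near_pupd.
Qed.

Lemma has_pd_ext g h i x d : Om x -> (forall y, Om y -> g y = h y) ->
  has_pd g i x d -> has_pd h i x d.
Proof.
move=> Hx E; have [r [r0 Hr]] := open_pupd x i Hx.
apply: (has_cderiv_near _ _ _ _ _ r0) => u Hu; apply: E; apply: Hr.
by have -> : (C0 + u = u)%C by ring.
Qed.

Lemma holo_pdiff g i x : holo_at g x -> pdiff g i x.
Proof.
move=> [d Hd]; exists (d i) => eps He; have [del [D0 H]] := Hd eps He.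
exists del; split=> // u Hu.
have -> : (C0 + u = u)%C by ring.
rewrite pupd0; have := H _ (near_pupd x i u _ Hu).
have Z k : k != i -> (pupd x i u k - x k = C0)%C by rewrite /pupd => /negbTE ->; ring.
have Zi : (pupd x i u i - x i = u)%C by rewrite /pupd eqxx; ring.
rewrite (Csum_pick _ i) ?Zi; last by move=> k /Z ->; ring.
suff -> : Rsum (fun k => Cnorm (pupd x i u k - x k)%C) = Cnorm u by [].
rewrite /Rsum (bigD1 i) //= Zi big1 ?Rplus_0_r // => k /Z ->; exact: Cnorm0.
Qed.

(** Freezing the other coordinates turns this into the one-variable theorem. The repeated direction
    [i] is the only second derivative that occurs in [B_i^2]. *)
Lemma holo_pdiff2 g i x : holomorphic Om g -> Om x -> pdiff (pderiv g i) i x.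
Proof.
move=> Hg Hx; have [r [r0 Hr]] := open_pupd x i Hx.
apply: (cderiv_cdiff (fun u => g (pupd x i u)) _ C0 r r0) => u Hu.
have -> : (C0 + u = u)%C by ring.
by apply: has_pd_shift; apply: pdiffP; apply: holo_pdiff; apply: Hg; exact: Hr.
Qed.

Lemma pdiff_minv n (A : pt N -> mat n) i x : Om x ->
  (forall y, Om y -> minvertible (A y)) -> (forall a b, pdiff (fun y => A y a b) i x) ->
  forall a b, pdiff (fun y => minv (A y) a b) i x.
Proof.
move=> Hx Hinv HA; have [r [r0 Hr]] := open_pupd x i Hx.
apply: (cdiff_minv (fun u => A (pupd x i u)) C0 r r0) => [u Hu|a b]; last exact: HA.
apply: Hinv; apply: Hr; by have -> : (C0 + u = u)%C by ring.
Qed.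

End OnOpenSet.

Lemma pdiff_mvmul n (A : pt N -> mat n) (f : pt N -> vec n) i x :
  (forall a b, pdiff (fun y => A y a b) i x) -> (forall a, pdiff (fun y => f y a) i x) ->
  forall a, has_pd (fun y => mvmul (A y) (f y) a) i x
    (vadd (mvmul (mpderiv A i x) (f x)) (mvmul (A x) (vpderiv f i x)) a).
Proof.
move=> HA Hf a; rewrite /mvmul /vadd -Csum_add; apply: has_pd_Csum => c.
by apply: has_pd_mul; [apply: pdiffP; exact: HA | apply: pdiffP; exact: Hf].
Qed.

End PartialDerivatives.

(** * The coefficients of the conjugated operators *)

(** The Dunkl part applied to [x_i g] yields [x_j / (x_i - x_j)] for the reflected term; when
    [j < i] the extra sum in [Uop] adds 1, which changes the numerator to [x_i]. *)
Definition phi {N} (x : pt N) (i j : 'I_N) : C :=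
  (x (if (j < i)%N then i else j) / (x i - x j))%C.

Definition pair_coef {N} (x : pt N) (i j : 'I_N) : C :=
  ((x i * x j) / ((x i - x j) * (x i - x j)))%C.

Section Coefficients.
Context {N : nat}.
Variable x : pt N.
Hypothesis x_inj : forall i j, i <> j -> x i <> x j.
Implicit Types i j k : 'I_N.

Lemma sub_coord_neq0 i j : i != j -> (x i - x j)%C <> C0.
Proof.
move=> /eqP /x_inj H E; apply: H.
by have -> : x i = (x i - x j + x j)%C; [ring | rewrite E; ring].
Qed.

Lemma phi_antisym i j : i != j -> phi x j i = (- phi x i j)%C.
Proof.
move=> Hij; have H1 := sub_coord_neq0 i j Hij.
have H2 : (x j - x i)%C <> C0 by apply: sub_coord_neq0; rewrite eq_sym.
rewrite /phi; case: (ltngtP i j) => [||/val_inj E].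
- by move=> _; field; split.
- by move=> _; field; split.
- by rewrite E eqxx in Hij.
Qed.

(** The numerator keeps its index while the coordinates are exchanged, so the two numerators
    multiply to [x_i x_j], and the denominators are opposite. *)
Lemma phi_tperm_diag i j : i != j ->
  (phi x i j * phi (pact x (tperm i j)) i j)%C = (- pair_coef x i j)%C.
Proof.
move=> Hij; have H1 := sub_coord_neq0 i j Hij.
have H2 : (x j - x i)%C <> C0 by apply: sub_coord_neq0; rewrite eq_sym.
by rewrite /phi /pair_coef /pact; case: ifP => _; rewrite ?tpermL ?tpermR; field; split.
Qed.

(** The numerators depend on the order of the indices, so the rational identity is checked for each
    of the six linear orders. The other two sign patterns are cyclic, hence contradictory. *)
Lemma phi_cyclic i j k : i != j -> j != k -> k != i ->
  (phi x i j * phi (pact x (tperm i j)) i k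
   + phi x j k * phi (pact x (tperm j k)) j i
   + phi x k i * phi (pact x (tperm k i)) k j)%C = C0.
Proof.
move=> Hij Hjk Hki.
have [Hji Hkj Hik] : [/\ j != i, k != j & i != k].
  by split; rewrite eq_sym.
have [N1 N2 N3] := And3 (sub_coord_neq0 i j Hij) (sub_coord_neq0 j k Hjk) (sub_coord_neq0 k i Hki).
have [N4 N5 N6] := And3 (sub_coord_neq0 j i Hji) (sub_coord_neq0 k j Hkj) (sub_coord_neq0 i k Hik).
rewrite /phi /pact.
case: (ltngtP i j) => [O1|O1|/val_inj E]; last by rewrite E eqxx in Hij.
- case: (ltngtP j k) => [O2|O2|/val_inj E]; last by rewrite E eqxx in Hjk.
  + case: (ltngtP k i) => [O3|O3|/val_inj E]; last by rewrite E eqxx in Hki.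
      by have := ltn_trans (ltn_trans O1 O2) O3; rewrite ltnn.
    by rewrite !tpermL ?tpermR !tpermD //; field; do ?split.
  + case: (ltngtP k i) => [O3|O3|/val_inj E]; last by rewrite E eqxx in Hki.
    * by rewrite !tpermL ?tpermR !tpermD //; field; do ?split.
    * by rewrite !tpermL ?tpermR !tpermD //; field; do ?split.
- case: (ltngtP j k) => [O2|O2|/val_inj E]; last by rewrite E eqxx in Hjk.
  + case: (ltngtP k i) => [O3|O3|/val_inj E]; last by rewrite E eqxx in Hki.
    * by rewrite !tpermL ?tpermR !tpermD //; field; do ?split.
    * by rewrite !tpermL ?tpermR !tpermD //; field; do ?split.
  + case: (ltngtP k i) => [O3|O3|/val_inj E]; last by rewrite E eqxx in Hki.
    * by rewrite !tpermL ?tpermR !tpermD //; field; do ?split.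
    * by have := ltn_trans (ltn_trans O2 O1) O3; rewrite ltnn.
Qed.

Lemma Csum_offdiag (G : 'I_N -> 'I_N -> C) :
  Csum (fun i => Csum (fun j => if j == i then C0 else G i j)) =
  Csum (fun i => Csum (fun j => if (i < j)%N then G i j + G j i else C0))%C.
Proof.
transitivity (Csum (fun i => Csum (fun j => if (i < j)%N then G i j else C0))
  + Csum (fun i => Csum (fun j => if (j < i)%N then G i j else C0)))%C.
  rewrite -Csum_add; apply: Csum_ext => i; rewrite -Csum_add; apply: Csum_ext => j.
  case: (ltngtP i j) => [H|H|/val_inj ->]; last by rewrite eqxx; ring.
  - by rewrite ifN; [ring|apply/eqP => E; rewrite E ltnn in H].
  - by rewrite ifN; [ring|apply/eqP => E; rewrite E ltnn in H].
rewrite [X in (_ + X)%C]Csum_exchange -Csum_add; apply: Csum_ext => i.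
by rewrite -Csum_add; apply: Csum_ext => j; case: ifP => _; ring.
Qed.

(** Renaming the indices along the rotation gives three expressions for the same sum [T]; adding
    them yields [3 T = 0]. *)
Lemma Csum_cyclic (G : 'I_N -> 'I_N -> 'I_N -> C) :
  (forall i j k, G i j k + G j k i + G k i j = C0)%C ->
  Csum (fun i => Csum (fun j => Csum (fun k => G i j k))) = C0.
Proof.
move=> H; set T := Csum _.
have E1 : T = Csum (fun i => Csum (fun j => Csum (fun k => G j k i))).
  rewrite /T Csum_exchange.
  rewrite (Csum_ext _ _ (fun j => Csum (fun k => Csum (fun i => G i j k)))); last first.
    by move=> j; exact: Csum_exchange.
  rewrite Csum_exchange.
  rewrite (Csum_ext _ _ (fun k => Csum (fun i => Csum (fun j => G i j k)))) //.
  by move=> k; exact: Csum_exchange.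
have E2 : T = Csum (fun i => Csum (fun j => Csum (fun k => G k i j))).
  rewrite /T Csum_exchange.
  rewrite (Csum_ext _ _ (fun j => Csum (fun k => Csum (fun i => G i j k)))) //.
  by move=> j; exact: Csum_exchange.
have S : (T + T + T = C0)%C.
  rewrite {2}E1 {2}E2 /T -!Csum_add -[RHS](Csum0 N); apply: Csum_ext => i.
  rewrite -!Csum_add -[RHS](Csum0 N); apply: Csum_ext => j.
  by rewrite -!Csum_add -[RHS](Csum0 N); apply: Csum_ext => k.
have -> : T = (Cinv (C1 + C1 + C1) * (T + T + T))%C.
  by field => /(f_equal fst) /=; lra.
by rewrite S; ring.
Qed.

(** The algebra of the sum of squares, for one component at one point. [EE], [fa], [s], [A] and [t]
    stand for the values of [E_i^2 f], [f], [sigma(i,j) f], [sigma(i,j) E_i f] and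
    [sigma(i,j) sigma(i,k) f], where [E_i = x_i d_i]. *)
Lemma sum_of_squares_coefs (kap : C) (EE : 'I_N -> C) (fa : C)
    (s A : 'I_N -> 'I_N -> C) (t : 'I_N -> 'I_N -> 'I_N -> C) :
  (forall i j, s j i = s i j) ->
  (forall i j, i != j -> t i j j = fa) ->
  (forall i j k, i != j -> j != k -> k != i -> t i j k = t j k i) ->
  Csum (fun i => EE i
     - kap * Csum (fun j => if j == i then C0 else - pair_coef x i j * s i j + phi x i j * A j i)
     - kap * Csum (fun j => if j == i then C0 else phi x i j *
        (A i j - kap * Csum (fun k => if k == i then C0 else phi (pact x (tperm i j)) i k * t i j k))))%C
  = (Csum EE - (C1 + C1) * kap *
      Csum (fun i => Csum (fun j => if (i < j)%N then pair_coef x i j * (kap * fa - s i j) else C0)))%C.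
Proof.
move=> Hs Ht1 Ht2.
have csym i j : i != j -> pair_coef x j i = pair_coef x i j.
  move=> Hij; have H1 := sub_coord_neq0 i j Hij.
  have H2 : (x j - x i)%C <> C0 by apply: sub_coord_neq0; rewrite eq_sym.
  by rewrite /pair_coef; field; split.
pose Q (G : 'I_N -> 'I_N -> C) := Csum (fun i => Csum (fun j => if (i < j)%N then G i j else C0)).
have ltne i j : (i < j)%N -> i != j by move=> H; apply/eqP => E; rewrite E ltnn in H.
(* [S1] collects the derivatives of [phi], [S2] the first-order cross terms, [S3] the case [k = j]
   of the double reflections, and [S4] the triples of distinct indices. *)
pose S1 := Csum (fun i => Csum (fun j => if j == i then C0 else - pair_coef x i j * s i j))%C.
pose S2 := Csum (fun i => Csum (fun j => if j == i then C0 else phi x i j * (A j i + A i j)))%C.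
pose S3 := Csum (fun i => Csum (fun j => if j == i then C0 else
  (phi x i j * phi (pact x (tperm i j)) i j) * fa))%C.
pose S4 := Csum (fun i => Csum (fun j => Csum (fun k =>
  if [&& j != i, k != i & k != j] then phi x i j * phi (pact x (tperm i j)) i k * t i j k else C0)))%C.
have E1 : S1 = (- (C1 + C1) * Q (fun i j => pair_coef x i j * s i j))%C.
  rewrite /S1 Csum_offdiag /Q -Csum_mull; apply: Csum_ext => i; rewrite -Csum_mull.
  apply: Csum_ext => j; case: ifP => [H|_]; last by ring.
  by rewrite (csym i j) ?(Hs i j) ?ltne //; ring.
have E2 : S2 = C0.
  rewrite /S2 Csum_offdiag -[RHS](Csum0 N); apply: Csum_ext => i.
  rewrite -[RHS](Csum0 N); apply: Csum_ext => j; case: ifP => [H|//].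
  by rewrite (phi_antisym i j) ?ltne //; ring.
have E3 : S3 = (- (C1 + C1) * Q (fun i j => pair_coef x i j * fa))%C.
  rewrite /S3 Csum_offdiag /Q -Csum_mull; apply: Csum_ext => i; rewrite -Csum_mull.
  apply: Csum_ext => j; case: ifP => [H|_]; last by ring.
  have Hij := ltne i j H.
  have Hji : j != i by rewrite eq_sym.
  by rewrite (phi_tperm_diag i j) // (phi_tperm_diag j i) // (csym i j) //; ring.
have E4 : S4 = C0.
  apply: Csum_cyclic => i j k.
  have -> : [&& k != j, i != j & i != k] = [&& j != i, k != i & k != j].
    by rewrite (eq_sym i j) (eq_sym i k); case: (k == j); case: (j == i); case: (k == i).
  have -> : [&& i != k, j != k & j != i] = [&& j != i, k != i & k != j].
    by rewrite (eq_sym j k) (eq_sym i k); case: (k == j); case: (j == i); case: (k == i).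
  case: ifP => [/and3P [Hji Hki Hkj]|_]; last by ring.
  have Hij : i != j by rewrite eq_sym.
  have Hjk : j != k by rewrite eq_sym.
  rewrite -(Ht2 k i j) // -(Ht2 i j k) //.
  rewrite (Ht2 k i j) //.
  have := phi_cyclic i j k Hij Hjk Hki.
  set a := (phi x i j * _)%C; set b := (phi x j k * _)%C; set c := (phi x k i * _)%C.
  move=> E; have -> : (a * t i j k + b * t i j k + c * t i j k = (a + b + c) * t i j k)%C by ring.
  by rewrite E; ring.
have E5 : Csum (fun i => Csum (fun j => if j == i then C0 else phi x i j *
    Csum (fun k => if k == i then C0 else phi (pact x (tperm i j)) i k * t i j k)))%C = (S3 + S4)%C.
  rewrite /S3 /S4 -Csum_add; apply: Csum_ext => i; rewrite -Csum_add; apply: Csum_ext => j.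
  case: (boolP (j == i)) => [_|Hji] /=.
    by rewrite Csum0; ring.
  rewrite -Csum_mull.
  transitivity (Csum (fun k => (if k == j then phi x i j * phi (pact x (tperm i j)) i k * fa else C0) +
     (if (k != i) && (k != j) then phi x i j * phi (pact x (tperm i j)) i k * t i j k else C0)))%C.
    apply: Csum_ext => k; case: (eqVneq k j) => [->|Hkj].
      by rewrite (negbTE Hji) Ht1 ?(eq_sym i j) // andbF; ring.
    by rewrite andbT; case: (k == i) => /=; ring.
  rewrite Csum_add (Csum_pick _ j) ?eqxx //.
  by move=> k /negbTE ->.
transitivity (Csum EE - kap * S1 - kap * S2 + kap * kap * (S3 + S4))%C.
  rewrite -E5 /S1 /S2 -!Csum_mull -!Csum_sub -Csum_add; apply: Csum_ext => i.
  suff : (Csum (fun j => if j == i then C0 else - pair_coef x i j * s i j + phi x i j * A j i)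
    + Csum (fun j => if j == i then C0 else phi x i j *
        (A i j - kap * Csum (fun k => if k == i then C0 else phi (pact x (tperm i j)) i k * t i j k)))
    = Csum (fun j => if j == i then C0 else - pair_coef x i j * s i j)
    + Csum (fun j => if j == i then C0 else phi x i j * (A j i + A i j))
    - kap * Csum (fun j => if j == i then C0 else phi x i j *
        Csum (fun k => if k == i then C0 else phi (pact x (tperm i j)) i k * t i j k)))%C.
    set a := Csum _; set b := Csum _; set c := Csum _; set d := Csum _; set e := Csum _.
    move=> E; have -> : (EE i - kap * a - kap * b = EE i - kap * (a + b))%C by ring.
    by rewrite E; ring.
  rewrite -Csum_mull -!Csum_add -Csum_sub; apply: Csum_ext => j.
  by case: (j == i); ring.
rewrite E1 E2 E3 E4.
have -> : Csum (fun i => Csum (fun j => if (i < j)%N then pair_coef x i j * (kap * fa - s i j) else C0))%C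
  = (kap * Q (fun i j => pair_coef x i j * fa) - Q (fun i j => pair_coef x i j * s i j))%C.
  rewrite /Q -Csum_mull -Csum_sub; apply: Csum_ext => i; rewrite -Csum_mull -Csum_sub.
  by apply: Csum_ext => j; case: ifP => _; ring.
ring.
Qed.

End Coefficients.

(** * Conjugation by [L] *)

Section Conjugation.
Context {N n : nat}.
Variables (kap gam : R) (tau : {perm 'I_N} -> mat n) (Om : pt N -> Prop).
Variables (L : pt N -> mat n) (M : {perm 'I_N} -> pt N -> mat n).
Hypothesis Om_open : open_pts Om.
Hypothesis Om_reg : forall x, Om x -> regular_pt x.
Hypothesis Om_inv : forall (w : {perm 'I_N}) x, Om (pact x w) <-> Om x.
Hypothesis L_hol : holomorphic_mat Om L.
Hypothesis L_inv : forall x, Om x -> minvertible (L x).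
Hypothesis L_eq : forall (i : 'I_N) x, Om x ->
  mpderiv L i x =
  mscale (RtoC kap) (mmul (L x)
    (msub (msum (fun j : 'I_N => if j == i then mscale C0 (@mid _)
                                else mscale (Cinv (Csub (x i) (x j))) (tau (tperm i j))))
          (mscale (Cdiv (RtoC gam) (x i)) (@mid _)))).
Hypothesis M_loc : forall w x, Om x -> exists d, 0 < d /\
  forall y, Om y -> near_pt x y d -> M w y = M w x.
Hypothesis M_inv : forall w x, Om x -> minvertible (M w x).
Hypothesis M_one : forall x, Om x -> M 1%g x = @mid _.
Hypothesis M_cocycle : forall w1 w2 x, Om x ->
  M (wcomp w1 w2) x = mmul (M w2 (pact x w1)) (M w1 x).
Hypothesis LM : forall w x, Om x -> L (pact x w) = mmul (mmul (M w x) (L x)) (tau w).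

Implicit Types (f F : pt N -> vec n) (i j k : 'I_N) (x y : pt N).

Lemma pact1 x : pact x 1%g = x.
Proof. by apply: pt_ext => k; rewrite /pact perm1. Qed.

Lemma pact_wcomp x w1 w2 : pact x (wcomp w1 w2) = pact (pact x w1) w2.
Proof. by apply: pt_ext => k; rewrite /pact /wcomp permM. Qed.

Lemma wcomp_tperm (i j : 'I_N) : wcomp (tperm i j) (tperm i j) = 1%g.
Proof. exact: tperm2. Qed.

(** Both sides are the same 3-cycle; this makes [t i j k] invariant under rotation of its
    indices. *)
Lemma wcomp_tperm_cycle (i j k : 'I_N) : i != j -> j != k -> k != i ->
  wcomp (tperm i j) (tperm i k) = wcomp (tperm j k) (tperm j i).
Proof.
move=> Hij Hjk Hki; rewrite /wcomp; apply/permP => l; rewrite !permM.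
have [Hji Hkj Hik] : [/\ j != i, k != j & i != k] by split; rewrite eq_sym.
case: (eqVneq l i) => [->|li]; first by rewrite tpermL !tpermR tpermD // tpermL.
case: (eqVneq l j) => [->|lj].
  by rewrite (tpermD (x:=i) (y:=k)) // tpermR tpermL tpermD.
case: (eqVneq l k) => [->|lk].
  by rewrite tpermR tpermL (tpermD (x:=j) (y:=i)) // tpermR.
by rewrite !tpermD // eq_sym.
Qed.

Lemma Om_pact w x : Om x -> Om (pact x w).
Proof. exact: (proj2 (Om_inv w x)). Qed.

Lemma minv_mvmul (A : mat n) (v : vec n) : minvertible A -> mvmul (minv A) (mvmul A v) = v.
Proof. by move=> /minvP [_ I]; rewrite -mvmul_mmul I mvmul1. Qed.

Lemma mvmul_minv (A : mat n) (v : vec n) : minvertible A -> mvmul A (mvmul (minv A) v) = v.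
Proof. by move=> /minvP [I _]; rewrite -mvmul_mmul I mvmul1. Qed.

(** Inverting the cocycle relation reverses its factors to [M(w1,x)^-1 M(w2,xw1)^-1], which is the
    order in which the two operators act. *)
Lemma sigmaM_comp w1 w2 f x : Om x ->
  sigmaM M w1 (sigmaM M w2 f) x = sigmaM M (wcomp w1 w2) f x.
Proof.
move=> Hx; rewrite /sigmaM pact_wcomp -mvmul_mmul; congr (mvmul _ _).
have [A1 A2] := minvP _ (M_inv w1 x Hx).
have [B1 B2] := minvP _ (M_inv w2 _ (Om_pact w1 x Hx)).
symmetry; apply: minv_unique; rewrite M_cocycle //.
  by rewrite -mmulA (mmulA (M w1 x)) A1 mmul1 B1.
by rewrite -mmulA (mmulA (minv _) (M w2 _)) B2 mmul1 A2.
Qed.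

Lemma sigmaM_one f x : Om x -> sigmaM M 1%g f x = f x.
Proof.
move=> Hx; rewrite /sigmaM pact1 M_one // (minv_unique _ (@mid n)) ?mmul1 //.
exact: mvmul1.
Qed.

(** By the monodromy relation [L(x) tau(w) = M(w,x)^-1 L(xw)], and this [L(xw)] cancels the inverse
    inside. *)
Lemma sigmaM_conj F i j x : Om x ->
  mvmul (L x) (mvmul (tau (tperm i j)) (mvmul (minv (L (pact x (tperm i j)))) (F (pact x (tperm i j)))))
  = sigmaM M (tperm i j) F x.
Proof.
move=> Hx; have Hy := Om_pact (tperm i j) x Hx.
rewrite /sigmaM; set y := pact x _ in Hy *.
set v := mvmul (minv (L y)) (F y).
have -> : F y = mvmul (L y) v by rewrite mvmul_minv //; exact: L_inv.
have -> : L y = mmul (mmul (M (tperm i j) x) (L x)) (tau (tperm i j)) by exact: LM.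
by rewrite !mvmul_mmul minv_mvmul //; exact: M_inv.
Qed.

Definition Bop i F x : vec n :=
  vsub (Euler i F x) (vscale (RtoC kap) (vsum (fun j : 'I_N =>
    if j == i then @vzero n else vscale (phi x i j) (sigmaM M (tperm i j) F x)))).

Lemma L_pdiff i x a b : Om x -> pdiff (fun y => L y a b) i x.
Proof. by move=> Hx; apply: holo_pdiff; exact: L_hol. Qed.

(** The summand [F x] is what the 1 in the shift removes. *)
Lemma vpderiv_coord_scale i x F : (forall a, pdiff (fun y => F y a) i x) ->
  vpderiv (fun y => vscale (y i) (F y)) i x = vadd (F x) (vscale (x i) (vpderiv F i x)).
Proof.
move=> HF; apply: vec_ext => a; rewrite /vpderiv /vadd /vscale.
have := has_pd_mul _ _ _ _ _ _ (has_pd_coord i x i) (pdiffP _ _ _ (HF a)).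
by move=> /pderivE ->; rewrite eqxx; ring.
Qed.

(** Product rule for [L (L^-1 F)], which equals [F] on [Om]. Only the existence of the derivative of
    [L^-1] enters, never a formula for it. *)
Lemma L_vpderiv_conj i x F : Om x -> (forall a, pdiff (fun y => F y a) i x) ->
  (forall a, pdiff (fun y => mvmul (minv (L y)) (F y) a) i x) /\
  mvmul (L x) (vpderiv (fun y => mvmul (minv (L y)) (F y)) i x) =
  vsub (vpderiv F i x) (mvmul (mpderiv L i x) (mvmul (minv (L x)) (F x))).
Proof.
move=> Hx HF.
have Hg a : pdiff (fun y => mvmul (minv (L y)) (F y) a) i x.
  eexists; apply: pdiff_mvmul => // b c.
  by apply: (pdiff_minv _ Om_open _ L _ _ Hx L_inv) => ? ?; exact: L_pdiff.
split=> //; apply: vec_ext => a.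
have H := pdiff_mvmul _ L (fun y => mvmul (minv (L y)) (F y)) i x (fun a b => L_pdiff i x a b Hx) Hg a.
have := has_pd_ext _ Om_open _ (fun y => F y a) _ _ _ Hx _ H.
move=> /(_ ltac:(by move=> y Hy; rewrite mvmul_minv //; exact: L_inv)) /pderivE.
by rewrite /vsub /vpderiv => ->; rewrite /vadd; ring.
Qed.

(** The unreflected [tau(i,j)] terms of the Dunkl part cancel those of the differential equation.
    The product-rule term and the term from [gamma / x_i] cancel the shift [1 + kappa gamma]. The
    reflected terms combine to [phi]. *)
Lemma Ushift_conj i F x : Om x -> (forall a, pdiff (fun y => F y a) i x) ->
  mvmul (L x) (Ushift kap tau gam i (fun y => mvmul (minv (L y)) (F y)) x) = Bop i F x.
Proof.
move=> Hx HF; have [Hg HG] := L_vpderiv_conj i x F Hx HF.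
set g := fun y => mvmul (minv (L y)) (F y) in Hg HG *.
have Lg : mvmul (L x) (g x) = F x by rewrite mvmul_minv //; exact: L_inv.
have [R0 Rinj] := Om_reg x Hx.
have Lsig j : mvmul (L x) (mvmul (tau (tperm i j)) (g (pact x (tperm i j)))) = sigmaM M (tperm i j) F x.
  exact: sigmaM_conj.
rewrite /Ushift /Uop /Dop vpderiv_coord_scale //.
rewrite !(mvmul_sub, mvmul_add, mvmul_scale) Lg HG.
rewrite L_eq // -/(g x) mvmul_mscale mvmul_mmul mvmul_msub mvmul_msum mvmul_mscale mvmul1.
rewrite mvmul_sub mvmul_scale Lg !mvmul_vsum.
rewrite /Bop /Euler; apply: vec_ext => a; rewrite /vsub /vadd /vscale /vsum.
(* [T] is the unreflected and [s] the reflected contribution. [S1] cancels in the end, while [S2]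
   and [S3] together are the [phi] sum of [Bop]. *)
pose T j := mvmul (L x) (mvmul (tau (tperm i j)) (g x)) a.
pose s j := sigmaM M (tperm i j) F x a.
pose S1 := Csum (fun j : 'I_N => if j == i then C0 else Cinv (x i - x j) * T j)%C.
pose S2 := Csum (fun j : 'I_N => if j == i then C0 else Cinv (x i - x j) * (x j * s j))%C.
pose S3 := Csum (fun j : 'I_N => if (j < i)%N then s j else C0).
rewrite [X in (RtoC kap * (X - _))%C](Csum_ext _ _
  (fun j : 'I_N => if j == i then C0 else Cinv (x i - x j) * T j)%C); last first.
  move=> j; case: ifP => _.
    by rewrite mvmul_mscale mvmul_scale /vscale; ring.
  by rewrite mvmul_mscale mvmul_scale.
rewrite (Csum_ext _ (fun j => mvmul (L x) (if (j < i)%N then _ else _) a)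
  (fun j => if (j < i)%N then s j else C0)); last first.
  by move=> j; case: ifP => _; rewrite ?Lsig ?mvmul0.
rewrite (Csum_ext _ (fun j => mvmul (L x) (if j == i then _ else _) a)
  (fun j => (x i) * (if j == i then C0 else Cinv (x i - x j) * T j)
     - (if j == i then C0 else Cinv (x i - x j) * (x j * s j)))%C); last first.
  move=> j; case: ifP => _; first by rewrite mvmul0 /vzero; ring.
  rewrite mvmul_scale !mvmul_sub !mvmul_scale /vscale /vsub.
  rewrite Lsig -/(T j) -/(s j) /pact tpermL; ring.
rewrite Csum_sub Csum_mull -/S1 -/S2 -/S3.
rewrite [X in _ = (_ - _ * X)%C](Csum_ext _ _ (fun j =>
  (if j == i then C0 else Cinv (x i - x j) * (x j * s j)) + (if (j < i)%N then s j else C0)))%C; last first.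
  move=> j; case: (eqVneq j i) => [->|Hji]; first by rewrite ltnn /vzero; ring.
  have H : (x i - x j)%C <> C0 by apply: sub_coord_neq0 => //; rewrite eq_sym.
  by rewrite /phi -/(s j); case: ifP => _; field.
rewrite Csum_add -/S2 -/S3.
have -> : RtoC (1 + kap * gam) = (C1 + RtoC kap * RtoC gam)%C by apply C_ext => /=; ring.
by field; exact: R0.
Qed.

(** Openness of [Om] makes the derivative local, and invariance keeps the reflected points in [Om].
    This is needed because the conjugation formula for the inner operator holds on [Om] only. *)
Lemma Ushift_ext i x (g h : pt N -> vec n) : Om x -> (forall y, Om y -> g y = h y) ->
  (forall a, pdiff (fun y => g y a) i x) ->
  Ushift kap tau gam i g x = Ushift kap tau gam i h x.
Proof.
move=> Hx E Hg.
have Hh a : pdiff (fun y => h y a) i x.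
  have [d Hd] := Hg a; exists d; apply: (has_pd_ext _ Om_open _ _ _ _ _ Hx _ Hd) => y Hy.
  by rewrite E.
have Ed : vpderiv g i x = vpderiv h i x.
  apply: vec_ext => a; rewrite /vpderiv; symmetry; apply: pderivE.
  by apply: (has_pd_ext _ Om_open _ _ _ _ _ Hx _ (pdiffP _ _ _ (Hg a))) => y Hy; rewrite E.
rewrite /Ushift /Uop /Dop !vpderiv_coord_scale // Ed E //.
have E' j : g (pact x (tperm i j)) = h (pact x (tperm i j)) by apply: E; exact: Om_pact.
congr vsub; congr vsub; [congr vadd|]; congr vscale; apply: vec_ext => a; apply: Csum_ext => j;
  by rewrite E'.
Qed.

(** Near [x] the matrix [M] can be frozen, and moving coordinate [i] of [x] moves coordinate [j] of
    the reflected point. *)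
Lemma sigmaM_pd i j f x a : Om x ->
  (forall b, pdiff (fun y => f y b) j (pact x (tperm i j))) ->
  has_pd (fun y => sigmaM M (tperm i j) f y a) i x
    (mvmul (minv (M (tperm i j) x)) (vpderiv f j (pact x (tperm i j))) a).
Proof.
move=> Hx Hf; set w := tperm i j.
have [r [r0 Hr]] := open_pupd _ Om_open x i Hx.
have [d [d0 Hd]] := M_loc w x Hx.
have m0 : 0 < Rmin r d by exact: Rmin_glb_lt.
apply: (has_cderiv_near (fun u => mvmul (minv (M w x)) (f (pact (pupd x i u) w)) a) _ _ _ _ m0).
  move=> u Hu; have -> : (C0 + u = u)%C by ring.
  rewrite /sigmaM (Hd (pupd x i u)) //.
    by apply: Hr; apply: Rlt_le_trans Hu (Rmin_l _ _).
  by apply: near_pupd; apply: Rlt_le_trans Hu (Rmin_r _ _).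
apply: (has_pd_Csum _ (fun c y => minv (M w x) a c * f (pact y w) c)%C) => c.
apply: has_pd_scal; have := pdiffP _ _ _ (Hf c); rewrite /has_pd.
apply: (has_cderiv_near _ _ _ _ 1 Rlt_0_1) => u _.
have wj : w j = i by exact: tpermR.
by have := pact_pupd x j (C0 + u)%C w; rewrite wj => ->.
Qed.

(** Both orders of [i] and [j] give the same derivative, since [x_i / (x_i - x_j) = 1 + x_j / (x_i -
    x_j)]. *)
Lemma phi_pd x i j : Om x -> j != i -> has_pd (fun y => phi y i j) i x
  (- (x j * (Cinv (x i - x j) * Cinv (x i - x j))))%C.
Proof.
move=> Hx Hji; have [_ Rinj] := Om_reg x Hx.
have Hij : i != j by rewrite eq_sym.
have H0 := sub_coord_neq0 x Rinj i j Hij.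
have Hs := has_pd_sub _ _ _ _ _ _ (has_pd_coord i x i) (has_pd_coord i x j).
rewrite eqxx (negbTE Hji) in Hs.
have := has_pd_mul _ _ _ _ _ _ (has_pd_coord i x (if (j < i)%N then i else j))
  (has_pd_inv _ _ _ _ H0 Hs).
rewrite /phi /Cdiv; case: ifP => _; rewrite ?eqxx ?(negbTE Hji) /Cdiv.
  set A := (_ + _)%C; set B := (- _)%C; suff -> : A = B by [].
  by rewrite /A /B; field.
set A := (_ + _)%C; set B := (- (x j * _))%C; suff -> : A = B by [].
by rewrite /A /B; field.
Qed.

(** * The squares of the conjugated operators and their sum *)

Section Main.
Variable f : pt N -> vec n.
Hypothesis f_hol : holomorphic_vec Om f.

Lemma f_pdiff i x a : Om x -> pdiff (fun y => f y a) i x.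
Proof. by move=> Hx; apply: holo_pdiff; exact: f_hol. Qed.

(** The Euler term is where twice differentiability enters; the reflected terms need first
    derivatives of [f] only. *)
Lemma Bop_pd i x a : Om x ->
  has_pd (fun y => Bop i f y a) i x
   (vpderiv (Euler i f) i x a - RtoC kap * Csum (fun j => if j == i then C0 else
      (- (x j * (Cinv (x i - x j) * Cinv (x i - x j)))) * sigmaM M (tperm i j) f x a
      + phi x i j * mvmul (minv (M (tperm i j) x)) (vpderiv f j (pact x (tperm i j))) a))%C.
Proof.
move=> Hx; rewrite /Bop /vsub; apply: has_pd_sub.
  apply: pdiffP; rewrite /Euler /vscale.
  have [d Hd] := holo_pdiff2 Om Om_open _ i x (f_hol a) Hx.
  by eexists; apply: has_pd_mul; [exact: has_pd_coord | exact: Hd].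
rewrite /vscale /vsum; apply: has_pd_scal.
apply: (has_pd_Csum _ (fun (j : 'I_N) y => (if j == i then @vzero n
  else (fun a => phi y i j * sigmaM M (tperm i j) f y a)%C) a)) => j.
case: (eqVneq j i) => [_|Hji]; first exact: has_pd_const.
apply: has_pd_mul; first exact: phi_pd.
by apply: sigmaM_pd => // b; apply: f_pdiff; exact: Om_pact.
Qed.

(** Multiplying [Bop_pd] by [x_i] turns the derivative of [phi] into [- pair_coef]. It also
    completes [d_j f] at the reflected point to [Euler j f], because coordinate [j] of that point is
    [x_i]. *)
Lemma Bop_square i x a : Om x ->
  Bop i (Bop i f) x a = (Euler i (Euler i f) x a
    - RtoC kap * Csum (fun j => if j == i then C0 else
        - pair_coef x i j * sigmaM M (tperm i j) f x a
        + phi x i j * sigmaM M (tperm j i) (Euler j f) x a)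
    - RtoC kap * Csum (fun j => if j == i then C0 else phi x i j *
        (sigmaM M (tperm i j) (Euler i f) x a
         - RtoC kap * Csum (fun k => if k == i then C0 else phi (pact x (tperm i j)) i k *
             sigmaM M (tperm i j) (sigmaM M (tperm i k) f) x a))))%C.
Proof.
move=> Hx; have [_ Rinj] := Om_reg x Hx.
rewrite {1}/Bop {1}/Euler /vsub /vscale /vsum /vpderiv (pderivE _ _ _ _ (Bop_pd i x a Hx)).
set P := Csum _; set Q := Csum _; set P' := Csum _; set Q' := Csum _.
have -> : Q = Q'.
  apply: Csum_ext => j; case: ifP => [//|_].
  congr Cmul; rewrite /sigmaM /Bop mvmul_sub mvmul_scale mvmul_vsum /vsub /vscale /vsum.
  congr (_ - _ * _)%C; apply: Csum_ext => k; case: ifP => _; first by rewrite mvmul0.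
  by rewrite -/(vscale _ _) mvmul_scale.
have -> : P' = (x i * P)%C.
  rewrite /P -Csum_mull; apply: Csum_ext => j; case: (eqVneq j i) => [_|Hji]; first by ring.
  have Hij : i != j by rewrite eq_sym.
  have H0 := sub_coord_neq0 x Rinj i j Hij.
  have -> : sigmaM M (tperm j i) (Euler j f) x a =
     (x i * mvmul (minv (M (tperm i j) x)) (vpderiv f j (pact x (tperm i j))) a)%C.
    by rewrite tpermC /sigmaM /Euler mvmul_scale /vscale {1}/pact tpermR.
  by rewrite /pair_coef; field.
by rewrite /Euler /vscale /vpderiv; ring.
Qed.

(** On [Om] the inner function equals [L^-1 (B_i f)], so [Ushift_conj] applies a second time, now to
    [B_i f]. *)
Lemma Ushift_square i x : Om x ->
  mvmul (L x) (Ushift kap tau gam i (Ushift kap tau gam i (fun y => mvmul (minv (L y)) (f y))) x)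
  = Bop i (Bop i f) x.
Proof.
move=> Hx.
have HB a : pdiff (fun y => Bop i f y a) i x by eexists; exact: Bop_pd.
rewrite -Ushift_conj //; congr mvmul; symmetry.
apply: Ushift_ext => //; last by case: (L_vpderiv_conj i x (Bop i f) Hx HB).
move=> y Hy; rewrite -Ushift_conj // ?minv_mvmul //; first exact: L_inv.
by move=> a; exact: f_pdiff.
Qed.

Lemma conjugated_hamiltonian x : Om x ->
  mvmul (L x) (vsum (fun i : 'I_N =>
    Ushift kap tau gam i (Ushift kap tau gam i (fun y => mvmul (minv (L y)) (f y))) x))
  = vsub (vsum (fun i : 'I_N => Euler i (Euler i f) x))
      (vscale (RtoC (2 * kap))
        (vsum (fun i : 'I_N => vsum (fun j : 'I_N =>
           if (i < j)%N then
             vscale (Cdiv (Cmul (x i) (x j)) (Cmul (Csub (x i) (x j)) (Csub (x i) (x j))))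
                    (vsub (vscale (RtoC kap) (f x)) (sigmaM M (tperm i j) f x))
           else @vzero _)))).
Proof.
move=> Hx; have [_ Rinj] := Om_reg x Hx.
rewrite mvmul_vsum; apply: vec_ext => a; rewrite /vsub /vscale /vsum.
rewrite (Csum_ext _ _ _ (fun i => f_equal (fun v => v a) (Ushift_square i x Hx))).
rewrite (Csum_ext _ _ _ (fun i => Bop_square i x a Hx)).
rewrite (sum_of_squares_coefs x Rinj (RtoC kap) (fun i => Euler i (Euler i f) x a) (f x a)
  (fun i j => sigmaM M (tperm i j) f x a) (fun i j => sigmaM M (tperm i j) (Euler i f) x a)
  (fun i j k => sigmaM M (tperm i j) (sigmaM M (tperm i k) f) x a)); first last.
(* The three facts about [sigma^M] that the algebra asks for: equal 3-cycles, involutivity of a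
   transposition, and symmetry in [i] and [j]. *)
- by move=> i j k Hij Hjk Hki; rewrite !sigmaM_comp // wcomp_tperm_cycle.
- by move=> i j _; rewrite sigmaM_comp // wcomp_tperm sigmaM_one.
- by move=> i j; rewrite tpermC.
have -> : RtoC (2 * kap) = ((C1 + C1) * RtoC kap)%C by apply C_ext => /=; ring.
congr (_ - _ * _)%C; apply: Csum_ext => i; apply: Csum_ext => j.
by case: ifP.
Qed.

End Main.
End Conjugation.

Theorem theorem1 (N : nat) (lam : seq nat)
  (Hlam : is_partition_of N lam)
  (Hnot_row : lam <> [:: N]) (Hnot_col : lam <> nseq N 1%N)
  (tau : {perm 'I_N} -> mat (ntau N lam))
  (Htau_hom : forall w1 w2, tau (wcomp w1 w2) = mmul (tau w1) (tau w2))
  (Htau_young : forall i j : 'I_N, nat_of_ord j = ((nat_of_ord i).+1)%N ->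
                  tau (tperm i j) = @young_adj N lam i j)
  (kap : R)
  (Om : pt N -> Prop) (HOm_open : open_pts Om)
  (HOm_reg : forall x, Om x -> regular_pt x)
  (HOm_inv : forall (w : {perm 'I_N}) x, Om (pact x w) <-> Om x)
  (L : pt N -> mat (ntau N lam))
  (HL_hol : holomorphic_mat Om L)
  (HL_inv : forall x, Om x -> minvertible (L x))
  (HL_eq : forall (i : 'I_N) x, Om x ->
     mpderiv L i x =
     mscale (RtoC kap) (mmul (L x)
       (msub (msum (fun j : 'I_N => if j == i then mscale C0 (@mid _)
                                   else mscale (Cinv (Csub (x i) (x j))) (tau (tperm i j))))
             (mscale (Cdiv (RtoC (S1 lam / INR N)) (x i)) (@mid _)))))
  (M : {perm 'I_N} -> pt N -> mat (ntau N lam))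
  (HM_loc : forall w x, Om x -> exists d, (0 < d) /\
              forall y, Om y -> near_pt x y d -> M w y = M w x)
  (HM_inv : forall w x, Om x -> minvertible (M w x))
  (HM_one : forall x, Om x -> M 1%g x = @mid _)
  (HM_cocycle : forall w1 w2 x, Om x ->
     M (wcomp w1 w2) x = mmul (M w2 (pact x w1)) (M w1 x))
  (HLM : forall w x, Om x -> L (pact x w) = mmul (mmul (M w x) (L x)) (tau w)) :
  let gam := (S1 lam / INR N) in
  forall f : pt N -> vec (ntau N lam), holomorphic_vec Om f ->
  forall x, Om x ->
    (* H_M f (x) = L(x) sum_i (U_i - 1 - kappa gamma)^2 (L^{-1} f) (x) *)
    mvmul (L x)
      (vsum (fun i : 'I_N =>
         Ushift kap tau gam i (Ushift kap tau gam i (fun y => mvmul (minv (L y)) (f y))) x))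
    =
    vsub
      (vsum (fun i : 'I_N => Euler i (Euler i f) x))
      (vscale (RtoC (2 * kap))
        (vsum (fun i : 'I_N => vsum (fun j : 'I_N =>
           if (i < j)%N then
             vscale (Cdiv (Cmul (x i) (x j)) (Cmul (Csub (x i) (x j)) (Csub (x i) (x j))))
                    (vsub (vscale (RtoC kap) (f x)) (sigmaM M (tperm i j) f x))
           else @vzero _)))).
Proof.
move=> gam f Hf x Hx.
exact: (conjugated_hamiltonian kap gam tau Om L M HOm_open HOm_reg HOm_inv
  HL_hol HL_inv HL_eq HM_loc HM_inv HM_one HM_cocycle HLM f Hf x Hx).
Qed.
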